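(* Let $\delta\ge0$, let $\Phi\colon V\to W$ be a $\delta$-invertible morphism of persistence modules, let $q\in\mathbb{R}_{\ge 0}$, and fix $q$-splittings of $V$ and $W$. 1. If $\delta<\frac12\min(\Xi(V),\Xi(W_{\ge q}))-\frac q2$, then the $(\delta+\frac q2)$-invertible morphism $pr^W_{\ge q}\circ\Phi\colon V\to W_{\ge q}$ decomposes as a ladder persistence module. 2. If $\delta<\frac12\min(\Xi(V_{\ge q}),\Xi(W))-\frac q2$, then the $(\delta+\frac q2)$-invertible morphism $\Phi\circ i^V_{\ge q}\colon V_{\ge q}\to W$ decomposes as a ladder persistence module. 3. If $\delta<\frac12\min(\Xi(V_{\ge q}),\Xi(W_{\ge q}))-\frac q2$, then the $(\delta+\frac q2)$-invertible morphism $pr^W_{\ge q}\circ\Phi\circ i^V_{\ge q}\colon V_{\ge q}\to W_{\ge q}$ decomposes as a ladder persistence module. Furthermore, the barcode bases in which these ladder decompositions are obtained can be extended to barcode bases of the persistence modules $V$ and $W$.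
   Context: Fix a field $\mathbb{F}$. A persistence module $V$ is a functor from $(\mathbb{R},\le)$ to $\mathbb{F}$-vector spaces, with inner morphisms $v_{s,t}\colon V_s\to V_t$ for $s\le t$, that is isomorphic to a finite direct sum of interval modules $k_J$, where $J=[i,j]$, $i\le j$, is a closed bounded interval and $k_J$ is $\mathbb{F}$ at indices in $J$, $0$ elsewhere, with identity inner morphisms inside $J$. The multiset of intervals in this decomposition is the barcode $\mathbf{Bar}(V)$; its elements are bars. The length of $J=[i,j]$ is $|J|=j-i$. A morphism $\Phi\colon V\to W$ is a family of linear maps $\Phi_t\colon V_t\to W_t$ commuting with inner morphisms. The shift $V(\delta)$ is given by $V(\delta)_t=V_{t+\delta}$, $v(\delta)_{s,t}=v_{s+\delta,t+\delta}$. A morphism $\Phi\colon V\to W$ is $\delta$-invertible if there is a morphism $\Psi\colon W\to V(2\delta)$ (a $\delta$-inverse) with $\Psi_t\circ\Phi_t=v_{t,t+2\delta}$ and $\Phi_{t+2\delta}\circ\Psi_t=w_{t,t+2\delta}$ for all $t$. Relations on intervals: $[i_1,j_1]\preceq[i_2,j_2]$ iff $i_1\le i_2\le j_1\le j_2$; $[i_1,j_1]\subset[i_2,j_2]$ (strictly nested) iff $i_2<i_1\le j_1<j_2$. Nestedness: $\Xi(V)=\min\{\min(|a-c|,|b-d|) : [a,b]\subset[c,d],\ [a,b],[c,d]\in\mathbf{Bar}(V)\}\in(0,\infty]$, equal to $\infty$ if there are no strictly nested bars. A $q$-splitting of $V$ is an isomorphism $V\cong V_{\ge q}\oplus V_{<q}$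 where all bars of $V_{\ge q}$ have length at least $q$ and all bars of $V_{<q}$ have length smaller than $q$. It induces projections $pr^V_{\ge q}\colon V\to V_{\ge q}$, $pr^V_{<q}\colon V\to V_{<q}$ and inclusions $i^V_{\ge q}\colon V_{\ge q}\to V$, $i^V_{<q}\colon V_{<q}\to V$. A barcode basis of $V$ is a finite collection of bar generators $x_J=\{(x_J)_t\in V_t\}_{t\in J}$, one for each bar $J$ of $\mathbf{Bar}(V)$ counted with multiplicity, such that for each $t$ the vectors $(x_J)_t$ with $J\ni t$ form a basis of $V_t$, and $v_{s,t}$ sends $(x_J)_s$ to $(x_J)_t$ if $t\in J$ and to $0$ otherwise. A barcode basis $\mathcal B$ of $V_{\ge q}$ extends to a barcode basis of $V$ if some barcode basis of $V$ contains $i^V_{\ge q}(\mathcal B)$ (and similarly for $W$). A ladder persistence module is a triple $(V,W,\Phi)$ with $\Phi\colon V\to W$ a morphism; isomorphisms are pairs of isomorphisms of the domains and codomains commuting with the morphisms; direct sums are componentwise. For $J_1\preceq J_2$, $\mathbf{R}_{J_1}^{J_2}=(k_{J_2},k_{J_1},\rho)$ with $\rho_t=\mathrm{id}$ for $t\in J_1\cap J_2$ and $0$ otherwise; $\mathbf{I}^+_J=(k_J,0,0)$; $\mathbf{I}^-_K=(0,k_K,0)$. A morphism $\Phi\colon V\to W$ decomposes as a ladder persistence module (admits a ladder decomposition) if $(V,W,\Phi)$ is isomorphic to a finite direct sum of modules of the form $\mathbf{R}_{J_1}^{J_2}$, $\mathbf{I}^+_J$, $\mathbf{I}^-_K$.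 Such an isomorphism corresponds to a choice of barcode bases of $V$ and $W$ (those in which the ladder decomposition is obtained): in these bases $\Phi$ sends each bar generator of $V$ either to a single bar generator of $W$ or to $0$, with distinct generators not sent to the same nonzero generator. *)

(* Defs.v *)
(* The real line is an arbitrary R : realType. *)
From HB Require Import structures.
From mathcomp Require Import all_boot all_order all_algebra.
From mathcomp Require Import boolp reals constructive_ereal.
Set Implicit Arguments.
Unset Strict Implicit.
Unset Printing Implicit Defensive.
Import Order.TTheory GRing.Theory Num.Theory.
Local Open Scope ring_scope.
Local Obligation Tactic := idtac.

Definition mk_linear (F : fieldType) (U V : lmodType F) (f : U -> V)
  (fL : linear f) : {linear U -> V} := HB.pack f (GRing.isLinear.Build F U V _ f fL).

Section Functors.
Variables (R : realType) (F : fieldType).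

Record pfunctor := PFunctor {
  pobj :> R -> lmodType F;
  ptr : forall s t : R, s <= t -> {linear pobj s -> pobj t};
  ptr_id : forall (t : R) (h : t <= t) x, ptr h x = x;
  ptr_comp : forall (s t u : R) (hst : s <= t) (htu : t <= u) (hsu : s <= u) x,
    ptr htu (ptr hst x) = ptr hsu x }.

Record pmor (V W : pfunctor) := PMor {
  pmap :> forall t : R, {linear V t -> W t};
  pmap_nat : forall (s t : R) (h : s <= t) x,
    pmap t (ptr V h x) = ptr W h (pmap s x) }.

Program Definition mcomp (U V W : pfunctor) (g : pmor V W) (f : pmor U V) :
  pmor U W := @PMor U W (fun t => g t \o f t : {linear U t -> W t}) _.
Next Obligation. by move=> U V W g f s t h x /=; rewrite !pmap_nat. Qed.

Record piso (V W : pfunctor) := PIso {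
  fwd : pmor V W;
  bwd : pmor W V;
  fwdK : forall t, cancel (fwd t) (bwd t);
  bwdK : forall t, cancel (bwd t) (fwd t) }.

Program Definition pshift (V : pfunctor) (d : R) : pfunctor :=
  @PFunctor (fun t => V (t + d))
    (fun s t h => @ptr V (s + d) (t + d) _) _ _.
Next Obligation. by move=> V d s t h; rewrite lerD2r. Qed.
Next Obligation. by move=> V d t h x; rewrite ptr_id. Qed.
Next Obligation. by move=> V d s t u hst htu hsu x; apply: ptr_comp. Qed.

Definition invertible (d : R) (V W : pfunctor) (Phi : pmor V W) : Prop :=
  0 <= d /\
  exists Psi : pmor W (pshift V (2 * d)),
    forall (t : R) (h : t <= t + 2 * d),
      (forall x : V t, Psi t (Phi t x) = ptr V h x) /\
      (forall y : W t, Phi (t + 2 * d) (Psi t y) = ptr W h y).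

Program Definition pzero : pfunctor :=
  @PFunctor (fun _ => 'rV[F]_0 : lmodType F) (fun _ _ _ => idfun) _ _.
Next Obligation. by []. Qed.
Next Obligation. by []. Qed.

Program Definition psum (V W : pfunctor) : pfunctor :=
  @PFunctor (fun t => (V t * W t)%type : lmodType F)
    (fun s t h => @mk_linear F (V s * W s)%type (V t * W t)%type
       (fun p => (ptr V h p.1, ptr W h p.2)) _) _ _.
Next Obligation. by move=> V W s t h a x y /=; rewrite !linearP. Qed.
Next Obligation. by move=> V W t h [x y] /=; rewrite !ptr_id. Qed.
Next Obligation.
by move=> V W s t u hst htu hsu [x y] /=; rewrite !(ptr_comp hst htu hsu).
Qed.

Program Definition pinl (V W : pfunctor) : pmor V (psum V W) :=
  @PMor V (psum V W)
    (fun t => @mk_linear F (V t) (V t * W t)%type (fun x => (x, 0)) _) _.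
Next Obligation.
by move=> V W t a x y; congr pair; rewrite /= scaler0 addr0.
Qed.
Next Obligation. by move=> V W s t h x; rewrite /= linear0. Qed.

Program Definition pinr (V W : pfunctor) : pmor W (psum V W) :=
  @PMor W (psum V W)
    (fun t => @mk_linear F (W t) (V t * W t)%type (fun x => (0, x)) _) _.
Next Obligation.
by move=> V W t a x y; congr pair; rewrite /= scaler0 addr0.
Qed.
Next Obligation. by move=> V W s t h x; rewrite /= linear0. Qed.

Program Definition pfst (V W : pfunctor) : pmor (psum V W) V :=
  @PMor (psum V W) V
    (fun t => @mk_linear F (V t * W t)%type (V t) (fun p => p.1) _) _.
Next Obligation. by []. Qed.
Next Obligation. by []. Qed.

Program Definition pzeromor (V W : pfunctor) : pmor V W :=
  @PMor V W (fun t => @mk_linear F (V t) (W t) (fun _ => 0) _) _.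
Next Obligation. by move=> V W t a x y; rewrite scaler0 addr0. Qed.
Next Obligation. by move=> V W s t h x; rewrite /= linear0. Qed.

Program Definition psummor (V V' W W' : pfunctor) (f : pmor V W)
    (g : pmor V' W') : pmor (psum V V') (psum W W') :=
  @PMor (psum V V') (psum W W')
    (fun t => @mk_linear F (V t * V' t)%type (W t * W' t)%type
       (fun p => (f t p.1, g t p.2)) _) _.
Next Obligation. by move=> V V' W W' f g t a x y /=; rewrite !linearP. Qed.
Next Obligation. by move=> V V' W W' f g s t h x; rewrite /= !pmap_nat. Qed.

Definition bar := {p : R * R | p.1 <= p.2}.
Definition blo (J : bar) : R := (val J).1.
Definition bhi (J : bar) : R := (val J).2.
Definition blen (J : bar) : R := bhi J - blo J.
Definition inbar (J : bar) (t : R) : bool := t \in `[blo J, bhi J].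

Definition bar_prec (J1 J2 : bar) : bool :=
  [&& blo J1 <= blo J2, blo J2 <= bhi J1 & bhi J1 <= bhi J2].
Definition bar_nested (J1 J2 : bar) : bool :=
  (blo J2 < blo J1) && (bhi J1 < bhi J2).

Lemma const_mx1M (a b c : bool) : (a -> c -> b) ->
  (const_mx 1 : 'M[F]_(a, b)) *m (const_mx 1 : 'M[F]_(b, c)) = const_mx 1.
Proof.
move=> hb; apply/matrixP => i j; rewrite !mxE.
have ha : a by case: (a) i => // -[].
have hc : c by case: (c) j => // -[].
by rewrite (hb ha hc) big_ord_recl big_ord0 !mxE mulr1 addr0.
Qed.

(* k_J is 'rV_1 = F at t \in J and 'rV_0 = 0 elsewhere.  The all-ones matrix is
   the 1 x 1 identity between two nonzero spaces and is empty (the zero map)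
   when one of the two spaces is 0. *)
Program Definition kmod (J : bar) : pfunctor :=
  @PFunctor (fun t => 'rV[F]_(inbar J t) : lmodType F)
    (fun s t _ => mulmxr (const_mx 1 : 'M[F]_(inbar J s, inbar J t))) _ _.
Next Obligation.
move=> J t h x /=; rewrite -[RHS]mulmx1; congr mulmx; apply/matrixP => i j.
rewrite !mxE; move: i j; case: inbar => // i j; last by case: i.
by rewrite !ord1.
Qed.
Next Obligation.
move=> J s t u hst htu hsu x /=; rewrite -mulmxA; congr mulmx.
apply: const_mx1M; rewrite /inbar !in_itv /= => /andP[h1 _] /andP[_ h2].
by rewrite (le_trans h1 hst) (le_trans htu h2).
Qed.

Program Definition rho (J1 J2 : bar) (h : bar_prec J1 J2) :
    pmor (kmod J2) (kmod J1) :=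
  @PMor (kmod J2) (kmod J1)
    (fun t => mulmxr (const_mx 1 : 'M[F]_(inbar J2 t, inbar J1 t))) _.
Next Obligation.
move=> J1 J2 /and3P[h1 h2 h3] s t hst x /=; rewrite -!mulmxA; congr mulmx.
rewrite !const_mx1M // /inbar !in_itv /= => /andP[a1 _] /andP[_ b2].
  by rewrite (le_trans h1 a1) (le_trans hst b2).
by rewrite (le_trans a1 hst) (le_trans b2 h3).
Qed.

Definition kmod_sum (s : seq bar) : pfunctor :=
  foldr (fun J V => psum (kmod J) V) pzero s.

Record pmod := PMod {
  pmod_functor :> pfunctor;
  pmod_decomp : exists s : seq bar, inhabited (piso pmod_functor (kmod_sum s)) }.

(* The order of the list is an arbitrary choice: only its class up to perm_eq
   is determined by V. *)
Definition Bar (V : pmod) : seq bar := sval (cid (pmod_decomp V)).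

Definition Xi (V : pmod) : \bar R :=
  \big[Order.min/+oo%E]_(I <- Bar V)
    \big[Order.min/+oo%E]_(J <- Bar V | bar_nested I J)
      (Num.min `|blo I - blo J| `|bhi I - bhi J|)%:E.

Record qsplitting (q : R) (V : pmod) := QSplitting {
  qge : pmod;
  qlt : pmod;
  qiso : piso V (psum qge qlt);
  qgeP : all (fun J => q <= blen J) (Bar qge);
  qltP : all (fun J => blen J < q) (Bar qlt) }.

Definition pr_ge (q : R) (V : pmod) (S : qsplitting q V) : pmor V (qge S) :=
  mcomp (pfst (qge S) (qlt S)) (fwd (qiso S)).
Definition in_ge (q : R) (V : pmod) (S : qsplitting q V) : pmor (qge S) V :=
  mcomp (bwd (qiso S)) (pinl (qge S) (qlt S)).

(* A bar J with a vector at every index; in a barcode basis the vectors at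
   indices outside J are required to be 0, so they carry no information. *)
Record bargen (V : pfunctor) := BarGen {
  gbar : bar;
  gvec : forall t : R, V t }.

Definition gmap (V W : pfunctor) (f : pmor V W) (x : bargen V) : bargen W :=
  BarGen (gbar x) (fun t => f t (gvec x t)).

Definition is_basis (E : lmodType F) (e : seq E) : Prop :=
  (forall c : 'I_(size e) -> F,
     \sum_(i < size e) c i *: e`_i = 0 -> forall i, c i = 0) /\
  (forall v : E, exists c : 'I_(size e) -> F,
     v = \sum_(i < size e) c i *: e`_i).

Definition vecs_at (V : pfunctor) (B : seq (bargen V)) (t : R) : seq (V t) :=
  [seq gvec x t | x <- B & inbar (gbar x) t].

(* In the transition clause the vector gvec x t is 0 when t is outside the bar
   (previous clause), so it also says that ptr kills the generator there. *)
Definition barcode_basis (V : pmod) (B : seq (bargen V)) : Prop :=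
  [/\ perm_eq (map (@gbar V) B) (Bar V),
      forall t : R, is_basis (vecs_at B t),
      forall i : 'I_(size B), let x := tnth (in_tuple B) i in
        forall t : R, ~~ inbar (gbar x) t -> gvec x t = 0 &
      forall i : 'I_(size B), let x := tnth (in_tuple B) i in
        forall (s t : R) (h : s <= t), inbar (gbar x) s ->
          ptr V h (gvec x s) = gvec x t].

Definition extends_along (U V : pmod) (f : pmor U V) (B : seq (bargen U)) :
  Prop :=
  barcode_basis B /\
  exists C : seq (bargen V), barcode_basis (map (gmap f) B ++ C).

Record ladder := Ladder {
  ldom : pfunctor;
  lcod : pfunctor;
  lmor : pmor ldom lcod }.

Record liso (A B : ladder) := LIso {
  liso_dom : piso (ldom A) (ldom B);
  liso_cod : piso (lcod A) (lcod B);
  liso_comm : forall t (x : ldom A t),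
    fwd liso_cod t (lmor A t x) = lmor B t (fwd liso_dom t x) }.

Definition lsum (A B : ladder) : ladder := Ladder (psummor (lmor A) (lmor B)).

Inductive lsummand :=
| LR (J1 J2 : bar) of bar_prec J1 J2
| LIplus of bar
| LIminus of bar.

Definition lmodule (l : lsummand) : ladder :=
  match l with
  | LR _ _ h => Ladder (rho h)
  | LIplus J => Ladder (pzeromor (kmod J) pzero)
  | LIminus K => Ladder (pzeromor pzero (kmod K))
  end.

Fixpoint lmodule_sum (L : seq lsummand) : ladder :=
  if L is l :: L' then lsum (lmodule l) (lmodule_sum L')
  else Ladder (pzeromor pzero pzero).

Definition ladder_decomposable (V W : pfunctor) (Phi : pmor V W) : Prop :=
  exists L : seq lsummand, inhabited (liso (Ladder Phi) (lmodule_sum L)).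

Definition kgen (J : bar) : bargen (kmod J) :=
  @BarGen (kmod J) J (fun t => const_mx 1 : 'rV[F]_(inbar J t)).

Definition lsummand_dom_gens (l : lsummand) : seq (bargen (ldom (lmodule l))) :=
  match l with
  | LR _ J2 _ => [:: kgen J2]
  | LIplus J => [:: kgen J]
  | LIminus _ => [::]
  end.

Definition lsummand_cod_gens (l : lsummand) : seq (bargen (lcod (lmodule l))) :=
  match l with
  | LR J1 _ _ => [:: kgen J1]
  | LIplus _ => [::]
  | LIminus K => [:: kgen K]
  end.

Fixpoint sum_dom_gens (L : seq lsummand) : seq (bargen (ldom (lmodule_sum L))) :=
  if L is l :: L' then
    map (gmap (pinl (ldom (lmodule l)) (ldom (lmodule_sum L'))))
      (lsummand_dom_gens l) ++
    map (gmap (pinr (ldom (lmodule l)) (ldom (lmodule_sum L'))))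
      (sum_dom_gens L')
  else [::].

Fixpoint sum_cod_gens (L : seq lsummand) : seq (bargen (lcod (lmodule_sum L))) :=
  if L is l :: L' then
    map (gmap (pinl (lcod (lmodule l)) (lcod (lmodule_sum L'))))
      (lsummand_cod_gens l) ++
    map (gmap (pinr (lcod (lmodule l)) (lcod (lmodule_sum L'))))
      (sum_cod_gens L')
  else [::].

(* The bar generators of V and W in which a ladder decomposition is obtained:
   the preimages of the canonical generators of its interval summands. *)
Definition dom_basis (V W : pfunctor) (Phi : pmor V W) (L : seq lsummand)
    (D : liso (Ladder Phi) (lmodule_sum L)) : seq (bargen V) :=
  map (gmap (bwd (liso_dom D))) (sum_dom_gens L).
Definition cod_basis (V W : pfunctor) (Phi : pmor V W) (L : seq lsummand)
    (D : liso (Ladder Phi) (lmodule_sum L)) : seq (bargen W) :=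
  map (gmap (bwd (liso_cod D))) (sum_cod_gens L).

End Functors.

(* Main.v *)
Require Import Defs.
From mathcomp Require Import all_boot all_order all_algebra.
From mathcomp Require Import boolp reals constructive_ereal.
From mathcomp Require Import ring lra.
Set Implicit Arguments.
Unset Strict Implicit.
Unset Printing Implicit Defensive.
Import Order.TTheory GRing.Theory Num.Theory.
Local Open Scope ring_scope.

(* The composites with the projection and the inclusion are still invertible,
   at the price of q/2, because the short summand dies after time q.  It remains
   to decompose an (e/2)-invertible f : V -> W such that nested bars of V, and of
   W, have endpoints more than e apart.  In barcode bases, f is a matrix whose
   entry (I, J) can be nonzero only if J precedes I.  Call such an entry close if
   the endpoints of I and J differ by at most e.  A nonzero matrix has a nonzero
   close entry: evaluating the inverse relations at the left endpoint of a bar of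
   length at least e yields one, and entries between two shorter bars are close
   automatically.  At a nonzero close entry (I, J) for which the endpoints of I
   and J are nearest, the gap hypothesis rules out nesting, so every other bar J'
   in the row of I precedes J, and I precedes every other bar I' in the column of
   J.  Both can then be cleared by admissible base changes, and the elimination
   goes on with the remaining rows and columns until f is a partial matching. *)

(** * Barcode bases and coordinates *)

Section Bases.
Variables (R : realType) (F : fieldType).
Implicit Types (U V W : pfunctor R F).

(* The vectors are 0 outside the bars, so an inactive index contributes nothing
   to a sum; freeness at [t] only concerns families of coefficients supported
   on the bars that contain [t]. *)
Definition is_gbasis V (I : finType) (J : I -> bar R)
    (x : I -> forall t : R, V t) : Prop :=
  [/\ forall i t, ~~ inbar (J i) t -> x i t = 0,
      forall i s t (h : s <= t), inbar (J i) s -> ptr V h (x i s) = x i t,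
      forall t (c : I -> F), (forall i, ~~ inbar (J i) t -> c i = 0) ->
        \sum_i c i *: x i t = 0 -> forall i, c i = 0 &
      forall t v, exists c : I -> F, v = \sum_i c i *: x i t].

Record gbasis V (I : finType) (J : I -> bar R) := GBasis {
  gb_vec :> I -> forall t : R, V t;
  gb_laws : is_gbasis J gb_vec }.

Section Laws.
Variables (V : pfunctor R F) (I : finType) (J : I -> bar R) (X : gbasis V J).

Lemma gb_out i t : ~~ inbar (J i) t -> X i t = 0.
Proof. by case: (gb_laws X) => out _ _ _; apply: out. Qed.

Lemma gb_tr i s t (h : s <= t) : inbar (J i) s -> ptr V h (X i s) = X i t.
Proof. by case: (gb_laws X) => _ tr _ _; apply: tr. Qed.

Lemma gb_free t (c : I -> F) : (forall i, ~~ inbar (J i) t -> c i = 0) ->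
  \sum_i c i *: X i t = 0 -> forall i, c i = 0.
Proof. by case: (gb_laws X) => _ _ free _; apply: free. Qed.

Lemma gb_span t (v : V t) : exists c : I -> F, v = \sum_i c i *: X i t.
Proof. by case: (gb_laws X) => _ _ _; apply. Qed.

End Laws.

Lemma lo_inbar (J : bar R) : inbar J (blo J).
Proof. by rewrite /inbar in_itv /= lexx; case: J => -[a b]. Qed.

Lemma hi_inbar (J : bar R) : inbar J (bhi J).
Proof. by rewrite /inbar in_itv /= lexx andbT; case: J => -[a b]. Qed.

Lemma inbarE (J : bar R) t : inbar J t = (blo J <= t) && (t <= bhi J).
Proof. by rewrite /inbar in_itv. Qed.

Lemma blo_le_bhi (J : bar R) : blo J <= bhi J.
Proof. by case: J => -[a b]. Qed.

Lemma bar_prec_refl (K : bar R) : bar_prec K K.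
Proof. by rewrite /bar_prec !lexx blo_le_bhi. Qed.

Lemma bar_prec_anti (J K : bar R) : bar_prec J K -> bar_prec K J -> J = K.
Proof.
move=> /and3P[h1 _ h2] /and3P[h3 _ h4]; apply: val_inj.
rewrite [val J]surjective_pairing [val K]surjective_pairing.
by congr pair; apply: le_anti; rewrite ?h1 ?h2 /=.
Qed.

Section Coord.
Variables (V : pfunctor R F) (I : finType) (J : I -> bar R) (X : gbasis V J).

Lemma bcoord_ex t (v : V t) : exists c : I -> F,
  (forall i, ~~ inbar (J i) t -> c i = 0) /\ v = \sum_i c i *: X i t.
Proof.
have [c ->] := gb_span X v.
exists (fun i => if inbar (J i) t then c i else 0); split.
  by move=> i /negbTE ->.
apply: eq_bigr => i _; case: ifPn => // /(gb_out X) ->.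
by rewrite !scaler0.
Qed.

Definition bcoord t (v : V t) : I -> F := sval (cid (bcoord_ex v)).

Lemma bcoord_out t (v : V t) i : ~~ inbar (J i) t -> bcoord v i = 0.
Proof. by rewrite /bcoord; case: cid => /= c [h _]; apply: h. Qed.

Lemma bcoord_neq0 t (v : V t) i : bcoord v i != 0 -> inbar (J i) t.
Proof. by apply: contraR => /bcoord_out ->. Qed.

Lemma bcoordE t (v : V t) : v = \sum_i bcoord v i *: X i t.
Proof. by rewrite /bcoord; case: cid => /= c [_]. Qed.

Lemma bcoord_sum t (c : I -> F) i :
  bcoord (\sum_k c k *: X k t) i = if inbar (J i) t then c i else 0.
Proof.
case: ifPn => it; last exact: bcoord_out.
set v := \sum_k _.
(* Freeness applies only to families supported on the bars alive at [t], so the difference of the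
   two coordinate families is cut off accordingly. *)
pose d k := if inbar (J k) t then bcoord v k - c k else 0.
have : d i = 0.
  apply: (gb_free (X := X) (t := t)); first by move=> k /negbTE kt; rewrite /d kt.
  have -> : \sum_k d k *: X k t = \sum_k (bcoord v k *: X k t - c k *: X k t).
    apply: eq_bigr => k _; rewrite /d -scalerBl; case: ifPn => // /(gb_out X) ->.
    by rewrite !scaler0.
  by rewrite sumrB -bcoordE subrr.
by rewrite /d it => /eqP; rewrite subr_eq0 => /eqP.
Qed.

Lemma bcoord_gen t i k : inbar (J i) t -> bcoord (X i t) k = (k == i)%:R.
Proof.
move=> it; have -> : X i t = \sum_k (k == i)%:R *: X k t.
  by rewrite (bigD1 i) //= eqxx scale1r big1 ?addr0 // => m /negbTE ->; rewrite scale0r.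
rewrite bcoord_sum; case: ifPn => //; case: eqP => // -> /negP; by [].
Qed.

Lemma bcoord_linear t (T : finType) (a : T -> F) (v : T -> V t) i :
  bcoord (\sum_k a k *: v k) i = \sum_k a k * bcoord (v k) i.
Proof.
have [it|it] := boolP (inbar (J i) t); last first.
  by rewrite bcoord_out // big1 // => k _; rewrite bcoord_out ?mulr0.
have -> : \sum_k a k *: v k = \sum_j (\sum_k a k * bcoord (v k) j) *: X j t.
  under [RHS]eq_bigr => j _ do rewrite scaler_suml.
  rewrite exchange_big /=; apply: eq_bigr => k _.
  by rewrite [in LHS](bcoordE (v k)) scaler_sumr; apply: eq_bigr => j _; rewrite scalerA.
by rewrite bcoord_sum it.
Qed.

Lemma bcoord0 t i : bcoord (0 : V t) i = 0.
Proof.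
have -> : (0 : V t) = \sum_k (fun=> 0) k *: X k t by rewrite big1 // => k _; rewrite scale0r.
by rewrite bcoord_sum; case: ifP.
Qed.

(* Indices outside the bar carry coordinate 0, so this also says that an
   element born before the bar has no component along it. *)
Lemma bcoord_ptr s t (h : s <= t) (v : V s) i :
  inbar (J i) t -> bcoord (ptr V h v) i = bcoord v i.
Proof.
move=> it; rewrite [in LHS](bcoordE v) linear_sum.
have -> : \sum_k ptr V h (bcoord v k *: X k s) = \sum_k bcoord v k *: X k t.
  apply: eq_bigr => k _; rewrite linearZ /=.
  have [ks|ks] := boolP (inbar (J k) s); first by rewrite gb_tr.
  by rewrite bcoord_out // !scale0r.
by rewrite bcoord_sum it.
Qed.

Lemma bcoord_born s t (h : s <= t) (v : V s) i :
  bcoord (ptr V h v) i != 0 -> blo (J i) <= s.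
Proof.
move=> nz; have it := bcoord_neq0 nz; rewrite bcoord_ptr // in nz.
by have := bcoord_neq0 nz; rewrite inbarE => /andP[].
Qed.

(** A coordinate persists up to the right endpoint of its bar, where it would still be visible after
    [v] has died. *)
Lemma bcoord_dies s b (v : V s) i :
  (forall t (h : s <= t), b < t -> ptr V h v = 0) -> bcoord v i != 0 ->
  bhi (J i) <= b.
Proof.
move=> v0 nz; rewrite leNgt; apply/negP => lt.
have := bcoord_neq0 nz; rewrite inbarE => /andP[_ h].
have := bcoord_ptr h v (hi_inbar (J i)).
by rewrite v0 // bcoord0 => e; rewrite -e eqxx in nz.
Qed.

Lemma gb_after i t : bhi (J i) < t -> X i t = 0.
Proof. by move=> lt; rewrite gb_out // inbarE negb_and -!ltNge lt orbT. Qed.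

Lemma gb_dies s t (h : s <= t) i :
  bhi (J i) < t -> ptr V h (X i s) = 0.
Proof.
move=> lt; have [si|si] := boolP (inbar (J i) s); last by rewrite gb_out ?linear0.
by rewrite gb_tr // gb_after.
Qed.

Lemma gb_born i s : inbar (J i) s ->
  exists h : blo (J i) <= s, X i s = ptr V h (X i (blo (J i))).
Proof.
move=> si; have := si; rewrite inbarE => /andP[h _]; exists h.
by rewrite gb_tr // lo_inbar.
Qed.

End Coord.

Section Matrix.
Variables (V W : pfunctor R F) (I K : finType) (J : I -> bar R) (L : K -> bar R).
Variables (X : gbasis V J) (Y : gbasis W L) (f : pmor V W).

(* Rows are indexed by the bars of the domain. *)
Definition gmx i j : F := bcoord Y (f (blo (J i)) (X i (blo (J i)))) j.

(** The image of a generator has components only along bars alive at its birth, and it dies no later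
    than the generator. *)
Lemma gmx_prec i j : gmx i j != 0 -> bar_prec (L j) (J i).
Proof.
move=> nz; have := bcoord_neq0 nz; rewrite inbarE => /andP[h1 h2].
apply/and3P; split => //; apply: bcoord_dies nz => t h lt.
by rewrite -pmap_nat gb_dies ?linear0.
Qed.

(** The entries computed at birth describe [f] at every later time. Before birth [X i] is 0 while
    some [Y j] may be alive. *)
Lemma gmxE i t : blo (J i) <= t -> f t (X i t) = \sum_j gmx i j *: Y j t.
Proof.
move=> h; rewrite -(gb_tr X h (lo_inbar _)) pmap_nat.
rewrite [X in ptr _ _ X](bcoordE Y) linear_sum; apply: eq_bigr => j _.
rewrite linearZ -/(gmx i j) /=; have [->|/bcoord_neq0 nz] := eqVneq (gmx i j) 0.
  by rewrite !scale0r.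
by rewrite gb_tr.
Qed.

End Matrix.

(* The blocks of the two change-of-basis matrices indexed by the bars equal to B
   are inverse to each other: a product of two nonzero entries through a bar C
   forces C to precede B and B to precede C. *)
Lemma gbasis_count V (I K : finType) (J : I -> bar R) (L : K -> bar R)
    (X : gbasis V J) (Y : gbasis V L) (B : bar R) :
  (#|[pred i | J i == B]| <= #|[pred j | L j == B]|)%N.
Proof.
set P := [pred i | _]; set Q := [pred j | _]; pose a := blo B.
pose A := \matrix_(i < #|P|, j < #|Q|) bcoord Y (X (enum_val i) a) (enum_val j).
pose C := \matrix_(j < #|Q|, i < #|P|) bcoord X (Y (enum_val j) a) (enum_val i).
(* A right-invertible matrix has at most as many rows as columns. *)
apply: (@mulmx1_min _ _ _ A C); apply/matrixP => i i'; rewrite !mxE.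
have Pi (k : 'I_#|P|) : J (enum_val k) = B by have := enum_valP k; rewrite inE => /eqP.
have ia (k : 'I_#|P|) : inbar (J (enum_val k)) a by rewrite Pi lo_inbar.
have := bcoord_gen X (enum_val i') (ia i).
rewrite {1}(bcoordE Y (X (enum_val i) a)) bcoord_linear (bigID Q) /=.
rewrite [X in _ + X]big1 ?addr0; last first.
  move=> j nQ; apply/eqP; rewrite mulf_eq0; apply: contraNT nQ.
  rewrite negb_or => /andP[nz1 nz2].
  have := bcoord_neq0 nz1; rewrite inbarE => ja; have /andP[h1 h2] := ja.
  have [h e] := gb_born Y (bcoord_neq0 nz1).
  apply/eqP/bar_prec_anti; apply/and3P; split => //.
  - apply: bcoord_dies nz1 => t h' lt; apply: gb_dies; by rewrite Pi.
  - by rewrite e in nz2; have := bcoord_born nz2; rewrite Pi.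
  - apply: le_trans h1 (blo_le_bhi _).
  - rewrite -(Pi i'); apply: bcoord_dies nz2 => t h' lt; exact: gb_dies.
rewrite (inj_eq enum_val_inj) [i == i']eq_sym => <-.
have -> (G : K -> F) : \sum_(j | Q j) G j = \sum_(j in Q) G j by [].
by rewrite [RHS]big_enum_val; apply: eq_bigr => k _; rewrite !mxE.
Qed.

(** Makes the multiset of bars an invariant, so that any basis can be compared with the arbitrarily
    chosen list [Bar V]. *)
Lemma gbasis_bars V (I K : finType) (J : I -> bar R) (L : K -> bar R)
    (X : gbasis V J) (Y : gbasis V L) :
  perm_eq (map J (enum I)) (map L (enum K)).
Proof.
apply/allP => B _.
rewrite /= (count_map J) (count_map L).
have cE (T : finType) (M : T -> bar R) :
    count (preim M (pred1 B)) (enum T) = #|[pred i | M i == B]|.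
  rewrite cardE /enum_mem size_filter count_filter.
  by apply: eq_count => x; rewrite /= inE andbT.
by rewrite !cE eqn_leq !(gbasis_count X Y, gbasis_count Y X).
Qed.

End Bases.

(** * Base changes *)

Section Update.
Variables (R : realType) (F : fieldType).
Variables (V : pfunctor R F) (I : finType) (J : I -> bar R) (X : gbasis V J).

Lemma gb_tr_ge i s t (h : s <= t) : blo (J i) <= s -> ptr V h (X i s) = X i t.
Proof.
move=> lo; have [si|] := boolP (inbar (J i) s); first exact: gb_tr.
rewrite inbarE lo /= -ltNge => lt.
by rewrite !gb_after ?linear0 //; apply: lt_le_trans lt h.
Qed.

Variables (P Q : I -> I -> F).
Hypothesis P_prec : forall i k, P i k != 0 -> bar_prec (J k) (J i).
Hypothesis Q_prec : forall i k, Q i k != 0 -> bar_prec (J k) (J i).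
Hypothesis PQ : forall i l, \sum_k P i k * Q k l = (i == l)%:R.
Hypothesis QP : forall i l, \sum_k Q i k * P k l = (i == l)%:R.

(** The cut-off is there because some [X k] may be alive before [J i] starts. *)
Definition comb i t := if inbar (J i) t then \sum_k P i k *: X k t else 0.

Lemma combE i t : blo (J i) <= t -> comb i t = \sum_k P i k *: X k t.
Proof.
move=> lo; rewrite /comb inbarE lo /=; case: leP => // lt.
rewrite big1 // => k _; have [->|/P_prec /and3P[_ _ hi]] := eqVneq (P i k) 0.
  by rewrite scale0r.
by rewrite gb_after ?scaler0 //; apply: le_lt_trans lt.
Qed.

(** By precedence, each [X k] in the combination is born when [J i] starts and dead once [J i] is
    over. Freeness and spanning use that the inverse [Q] respects precedence too. *)
Lemma comb_basis : exists X' : gbasis V J,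
  forall i t, inbar (J i) t -> X' i t = \sum_k P i k *: X k t.
Proof.
suff H : is_gbasis J comb.
  exists (GBasis H) => i t it /=.
  by rewrite /comb it.
split.
- by move=> i t /negbTE it; rewrite /comb it.
- move=> i s t h; rewrite inbarE => /andP[lo _].
  rewrite !combE ?(le_trans lo) // linear_sum; apply: eq_bigr => k _.
  rewrite linearZ /=; have [->|/P_prec /and3P[lo' _ _]] := eqVneq (P i k) 0.
    by rewrite !scale0r.
  by rewrite gb_tr_ge // (le_trans lo').
- move=> t c c0 s0 i.
  pose d l := if inbar (J l) t then \sum_i c i * P i l else 0.
  have d0 : forall l, d l = 0.
    apply: (gb_free (X := X) (t := t)); first by move=> l /negbTE lt; rewrite /d lt.
    rewrite -[RHS]s0; transitivity (\sum_l \sum_i (c i * P i l) *: X l t).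
      apply: eq_bigr => l _; rewrite /d; case: ifPn => [_|lt].
        by rewrite scaler_suml.
      by rewrite scale0r big1 // => k _; rewrite gb_out ?scaler0.
    rewrite exchange_big; apply: eq_bigr => k _ /=.
    have [/[!inbarE] /andP[kt _]|/c0 ->] := boolP (inbar (J k) t); last first.
      by rewrite scale0r big1 // => l _; rewrite mul0r scale0r.
    by rewrite combE // scaler_sumr; apply: eq_bigr => l _; rewrite scalerA.
  have [it|/c0 //] := boolP (inbar (J i) t).
  have -> : c i = \sum_l (\sum_k c k * P k l) * Q l i.
    under eq_bigr => l _ do rewrite mulr_suml.
    rewrite exchange_big /= (bigD1 i) //= [X in _ + X]big1 ?addr0.
      by under eq_bigr => l _ do rewrite -mulrA; rewrite -mulr_sumr PQ eqxx mulr1.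
    move=> k /negbTE ki.
    by under eq_bigr => l _ do rewrite -mulrA; rewrite -mulr_sumr PQ ki mulr0.
  (* If [J l] is not alive at [t] but both factors are nonzero, then [J i] precedes [J l] and [J l]
     precedes some [J k], with [J i] and [J k] alive at [t]; this puts [t] in [J l]. *)
  rewrite big1 // => l _; have := d0 l; rewrite /d; case: ifPn => [_ -> | lt _].
    by rewrite mul0r.
  have [->|/Q_prec /and3P[lo _ hi]] := eqVneq (Q l i) 0; first by rewrite mulr0.
  have [->|nz] := eqVneq (\sum_k c k * P k l) 0; first by rewrite mul0r.
  have [k /andP[]] : exists k, (c k != 0) && (P k l != 0).
    apply/existsP; apply: contraNT nz => /existsPn nz; apply/eqP/big1 => k _.
    by have := nz k; rewrite negb_and !negbK => /orP[]/eqP->; rewrite ?mul0r ?mulr0.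
  move=> ck /P_prec /and3P[lo' _ _]; case/negP: lt.
  have kt : inbar (J k) t by apply: contraNT ck => /c0 ->.
  move: it kt; rewrite !inbarE => /andP[_ it] /andP[kt _].
  by rewrite (le_trans lo') // (le_trans it).
- move=> t v; exists (fun k => \sum_i bcoord X v i * Q i k).
  rewrite {1}(bcoordE X v).
  under [RHS]eq_bigr => k _ do rewrite scaler_suml.
  rewrite exchange_big; apply: eq_bigr => i _ /=.
  have [->|/bcoord_neq0 it] := eqVneq (bcoord X v i) 0.
    by rewrite scale0r big1 // => k _; rewrite mul0r scale0r.
  under eq_bigr => k _ do rewrite -scalerA; rewrite -scaler_sumr; congr (_ *: _).
  transitivity (\sum_k \sum_l (Q i k * P k l) *: X l t).
    rewrite exchange_big /=; under eq_bigr => l _ do rewrite -scaler_suml QP.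
    rewrite (bigD1 i) //= eqxx scale1r big1 ?addr0 // => l.
    by rewrite eq_sym => /negbTE ->; rewrite scale0r.
  apply: eq_bigr => k _; have [->|/Q_prec /and3P[lo _ _]] := eqVneq (Q i k) 0.
    by rewrite scale0r big1 // => l _; rewrite mul0r scale0r.
  rewrite combE; first by rewrite scaler_sumr; apply: eq_bigr => l _; rewrite scalerA.
  by move: it; rewrite inbarE => /andP[it _]; apply: le_trans lo it.
Qed.

End Update.

Section RankOne.
Variables (R : realType) (F : fieldType).
Variables (V : pfunctor R F) (I : finType) (J : I -> bar R) (X : gbasis V J).

(* Matrix product (1 + d u v^T) (1 + e u v^T). *)
Lemma rank_one_mul (u v : I -> F) (d e : F) i l :
  \sum_k ((i == k)%:R + d * (u i * v k)) * ((k == l)%:R + e * (u k * v l)) =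
  (i == l)%:R + (d + e + d * e * \sum_k v k * u k) * (u i * v l).
Proof.
have -> : \sum_k ((i == k)%:R + d * (u i * v k)) * ((k == l)%:R + e * (u k * v l))
  = \sum_k (i == k)%:R * ((k == l)%:R + e * (u k * v l)) +
    (\sum_k (k == l)%:R * (d * (u i * v k)) +
    \sum_k d * e * u i * v l * (v k * u k)).
  by rewrite -!big_split /=; apply: eq_bigr => k _; ring.
rewrite (bigD1 i) //= eqxx mul1r big1 ?addr0; last first.
  by move=> k; rewrite eq_sym => /negbTE ->; rewrite mul0r.
rewrite (bigD1 l) //= eqxx mul1r big1 ?addr0; last first.
  by move=> k /negbTE ->; rewrite mul0r.
by rewrite -mulr_sumr; ring.
Qed.

Lemma rank_one_update (u v : I -> F) : 1 + \sum_k v k * u k != 0 ->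
  (forall i k, u i != 0 -> v k != 0 -> bar_prec (J k) (J i)) ->
  exists X' : gbasis V J, forall i t, inbar (J i) t ->
    X' i t = X i t + u i *: \sum_k v k *: X k t.
Proof.
(* Sherman-Morrison: for this [e], the inverse of 1 + u v^T is 1 + e u v^T, with the same support
   off the diagonal. *)
move=> b0 uv; pose e := - (1 + \sum_k v k * u k)^-1.
pose P d i k : F := (i == k)%:R + d * (u i * v k).
have Pp d i k : P d i k != 0 -> bar_prec (J k) (J i).
  rewrite /P; have [<- _|_] := eqVneq i k; first exact: bar_prec_refl.
  rewrite add0r !mulf_eq0 !negb_or => /andP[_ /andP[]]; exact: uv.
have [||X' X'E] := comb_basis X (Pp 1) (Pp e).
- move=> i l; rewrite rank_one_mul [X in X * _](_ : _ = 0) ?mul0r ?addr0 //.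
  by rewrite /e; field.
- move=> i l; rewrite rank_one_mul [X in X * _](_ : _ = 0) ?mul0r ?addr0 //.
  by rewrite /e; field.
exists X' => i t it; rewrite X'E // /P.
under eq_bigr => k _ do rewrite mul1r scalerDl; rewrite big_split /=; congr (_ + _).
  rewrite (bigD1 i) //= eqxx scale1r big1 ?addr0 // => k.
  by rewrite eq_sym => /negbTE ->; rewrite scale0r.
by rewrite scaler_sumr; apply: eq_bigr => k _; rewrite scalerA.
Qed.

End RankOne.

(** * Gaussian elimination *)

Section Elimination.
Variables (R : realType) (F : fieldType).
Variables (V W : pfunctor R F) (I K : finType).
Variables (J : I -> bar R) (L : K -> bar R) (f : pmor V W).
Implicit Types (X : gbasis V J) (Y : gbasis W L) (S : {set I}) (T : {set K}).

(** A 0-1 matrix with at most one 1 in each row and each column. *)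
Definition matching X Y := forall i i' j j',
  gmx X Y f i j != 0 -> gmx X Y f i' j' != 0 ->
  gmx X Y f i j = 1 /\ (i == i') = (j == j').

(* The rows in S and the columns in T are already matched. *)
Definition resolved X Y S T :=
  (forall i j, gmx X Y f i j != 0 -> (i \in S) = (j \in T)) /\
  (forall i i' j j', i \in S -> i' \in S ->
     gmx X Y f i j != 0 -> gmx X Y f i' j' != 0 ->
     gmx X Y f i j = 1 /\ (i == i') = (j == j')).

Lemma gmx_eq X Y i j (c : K -> F) :
  f (blo (J i)) (X i (blo (J i))) = \sum_k c k *: Y k (blo (J i)) ->
  gmx X Y f i j = if inbar (L j) (blo (J i)) then c j else 0.
Proof. by rewrite /gmx => ->; rewrite bcoord_sum. Qed.

Lemma gmx_out X Y i j : ~~ inbar (L j) (blo (J i)) -> gmx X Y f i j = 0.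
Proof. exact: bcoord_out. Qed.

(** [Y j0] is replaced by the combination of the [Y k] with the coefficients of row [i0], so that
    row [i0] becomes a unit vector. The case on [inbar] is there because [A i0 j] may be nonzero for
    a bar [L j] that is not alive at the birth of [J i]. *)
Lemma clear_row X Y i0 j0 : gmx X Y f i0 j0 != 0 ->
  (forall j, gmx X Y f i0 j != 0 -> bar_prec (L j) (L j0)) ->
  exists Y', forall i j, gmx X Y' f i j =
    if j == j0 then gmx X Y f i j0 / gmx X Y f i0 j0
    else if inbar (L j) (blo (J i)) then
      gmx X Y f i j - gmx X Y f i j0 / gmx X Y f i0 j0 * gmx X Y f i0 j
    else 0.
Proof.
set A := gmx X Y f => nz prec.
(* Chosen so that adding the combination with coefficients [v] to [Y j0] gives the one with
   coefficients [A i0]; the pivot factor 1 + v j0 is then [A i0 j0]. *)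
pose v k := A i0 k - (k == j0)%:R.
have v0 k : v k != 0 -> bar_prec (L k) (L j0).
  rewrite /v; have [-> _|_] := eqVneq k j0; first exact: bar_prec_refl.
  by rewrite subr0; apply: prec.
have [||Y' Y'E] := @rank_one_update _ _ _ _ _ Y (fun j => (j == j0)%:R) v.
- rewrite (bigD1 j0) //= eqxx mulr1 big1 ?addr0.
    by rewrite /v eqxx addrC subrK.
  by move=> k /negbTE ->; rewrite mulr0.
- by move=> j k; have [-> _|_] := eqVneq j j0; [apply: v0 | rewrite eqxx].
have Y'n j t : j != j0 -> Y' j t = Y j t.
  move=> jj; have [jt|jt] := boolP (inbar (L j) t); last by rewrite !gb_out.
  by rewrite Y'E // (negbTE jj) scale0r addr0.
have Y'j t : inbar (L j0) t -> Y' j0 t = \sum_k A i0 k *: Y k t.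
  move=> jt; rewrite Y'E // eqxx scale1r.
  under eq_bigr => k _ do rewrite scalerBl; rewrite sumrB.
  rewrite [X in _ - X](bigD1 j0) //= eqxx scale1r [X in _ - (_ + X)]big1.
    by rewrite addr0 addrC subrK.
  by move=> k /negbTE ->; rewrite scale0r.
exists Y' => i j; set b := A i j0 / A i0 j0.
pose d k := if k == j0 then b else A i k - b * A i0 k.
rewrite (@gmx_eq X Y' i j d).
  rewrite /d; case: eqP => [->|//]; case: ifPn => // out.
  by rewrite /b [A i j0](gmx_out X Y out) mul0r.
rewrite (gmxE X Y) // -/A.
have e (C : K -> F) (Z : gbasis W L) t : \sum_k C k *: Z k t =
  C j0 *: Z j0 t + \sum_(k | k != j0) C k *: Z k t by rewrite (bigD1 j0).
rewrite [RHS]e {1}/d eqxx.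
have -> : b *: Y' j0 (blo (J i)) = \sum_k (b * A i0 k) *: Y k (blo (J i)).
  have [b0|/negP] := eqVneq b 0.
    by rewrite b0 scale0r big1 // => k _; rewrite mul0r scale0r.
  have [jt|out] := boolP (inbar (L j0) (blo (J i))).
    by rewrite Y'j // scaler_sumr => _; apply: eq_bigr => k _; rewrite scalerA.
  by rewrite /b [A i j0](gmx_out X Y out) mul0r.
rewrite !e -addrA /b divfK //; congr (_ + _).
rewrite -big_split /=; apply: eq_bigr => k kj.
by rewrite /d (negbTE kj) Y'n // -scalerDl addrC subrK.
Qed.

(** Once row [i0] is a unit vector, subtracting multiples of [X i0] from the other generators
    affects column [j0] only. *)
Lemma clear_column X Y i0 j0 : (forall j, gmx X Y f i0 j = (j == j0)%:R) ->
  (forall i, gmx X Y f i j0 != 0 -> bar_prec (J i0) (J i)) ->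
  exists X', forall i j, gmx X' Y f i j =
    if j == j0 then (i == i0)%:R else gmx X Y f i j.
Proof.
set A := gmx X Y f => A0 prec.
pose c i := if i == i0 then 0 else - A i j0.
have c0 i : c i != 0 -> bar_prec (J i0) (J i).
  rewrite /c; case: ifP => [_|_]; first by rewrite eqxx.
  by rewrite oppr_eq0; apply: prec.
have [||X' X'E] := @rank_one_update _ _ _ _ _ X c (fun k => (k == i0)%:R).
- rewrite big1 ?addr0 ?oner_eq0 // => k _; rewrite /c.
  by case: ifP; rewrite ?mulr0 ?mul0r.
- by move=> i k /c0 h; have [-> _|_] := eqVneq k i0; rewrite // eqxx.
exists X' => i j; set s := blo (J i).
have X'i : X' i s = X i s + c i *: X i0 s.
  rewrite X'E ?lo_inbar // (bigD1 i0) //= eqxx scale1r big1 ?addr0 // => k /negbTE ->.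
  by rewrite scale0r.
rewrite (@gmx_eq X' Y i j (fun k => A i k + c i * (k == j0)%:R)); last first.
  rewrite -/s X'i linearD linearZ /= (gmxE X Y) //.
  under [RHS]eq_bigr => k _ do rewrite scalerDl; rewrite big_split /=; congr (_ + _).
  have [->|/c0 /and3P[lo _ _]] := eqVneq (c i) 0.
    by rewrite scale0r big1 // => k _; rewrite mul0r scale0r.
  rewrite (gmxE X Y) // scaler_sumr; apply: eq_bigr => k _.
  by rewrite -/A A0 scalerA.
have [-> | jj] := eqVneq j j0.
  rewrite mulr1 /c; have [->|ii] := eqVneq i i0.
    have := A0 j0; rewrite eqxx => e; rewrite e addr0; case: ifPn => // out.
    by move/eqP: e; rewrite /A (gmx_out X Y out) eq_sym oner_eq0.
  by rewrite subrr if_same.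
rewrite mulr0 addr0; case: ifPn => // out.
by rewrite /A gmx_out.
Qed.

(** Rows in [S] vanish in column [j0], and rows outside [S] vanish in the columns of [T]. Hence
    clearing the pivot leaves the matched block and the zero blocks as they are. *)
Lemma resolve_pivot X Y S T i0 j0 : resolved X Y S T -> i0 \notin S ->
  gmx X Y f i0 j0 != 0 ->
  (forall j, gmx X Y f i0 j != 0 -> bar_prec (L j) (L j0)) ->
  (forall i, gmx X Y f i j0 != 0 -> bar_prec (J i0) (J i)) ->
  exists X' Y', resolved X' Y' (i0 |: S) (j0 |: T).
Proof.
move=> [bl mt] i0S nz col row.
have [Y' Y'E] := clear_row nz col.
have j0T : j0 \notin T by rewrite -(bl _ _ nz).
have A1i0 j : gmx X Y' f i0 j = (j == j0)%:R.
  rewrite Y'E divff //; case: eqP => // _.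
  by rewrite mul1r subrr if_same.
have A1S i j : i \in S -> gmx X Y' f i j = gmx X Y f i j.
  move=> iS; have z : gmx X Y f i j0 = 0.
    by apply/eqP; apply: contraNT j0T => /bl <-.
  rewrite Y'E z mul0r; case: eqP => [->|_] //; rewrite mul0r subr0.
  by case: ifPn => // out; rewrite gmx_out.
have A1T i j : i \notin S -> j \in T -> gmx X Y' f i j = 0.
  move=> iS jT; rewrite Y'E; case: eqP => [e|_]; first by rewrite e (negbTE j0T) in jT.
  have z k : k \notin S -> gmx X Y f k j = 0.
    by move=> kS; apply/eqP; apply: contraNT kS => /bl ->.
  by rewrite !z // mulr0 subr0 if_same.
have [i|X' X'E] := clear_column A1i0.
  rewrite Y'E eqxx mulf_eq0 negb_or => /andP[h _]; exact: row.
exists X', Y'.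
have A2S i j : i \in i0 |: S -> gmx X' Y' f i j =
    if i == i0 then (j == j0)%:R else gmx X Y f i j.
  rewrite !inE X'E; have [->|ii /= iS] := eqVneq i i0.
    by rewrite A1i0; case: eqP.
  rewrite -A1S //; case: eqP => // ->; rewrite A1S //; apply/esym/eqP.
  by apply: contraNT j0T => /bl <-.
split=> [i j|i i' j j' iS i'S].
  rewrite X'E !inE; have [->|jj] := eqVneq j j0.
    by have [->|] := eqVneq i i0; rewrite // eqxx.
  have [->|ii] := eqVneq i i0; first by rewrite A1i0 (negbTE jj) eqxx.
  move=> nz1 /=; have [iS|iS] := boolP (i \in S).
    by rewrite A1S // in nz1; rewrite -(bl _ _ nz1).
  by apply/esym; apply: contraNF nz1 => jT; rewrite A1T.
have mem k l : k \in S -> gmx X Y f k l != 0 -> l != j0.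
  by move=> kS /bl; rewrite kS => lT; apply: contraNneq j0T => <-.
have inS k : k \in i0 |: S -> k != i0 -> k \in S.
  by rewrite !inE => /orP[/eqP->|//]; rewrite eqxx.
rewrite !A2S //.
have [ei|ni] := eqVneq i i0; have [ei'|ni'] := eqVneq i' i0.
- have [-> _|_] := eqVneq j j0; last by rewrite eqxx.
  have [_ _|_] := eqVneq j' j0; last by rewrite eqxx.
  by rewrite ei ei' !eqxx.
- have [-> _|_] := eqVneq j j0; last by rewrite eqxx.
  move=> /(mem _ _ (inS _ i'S ni')) jn; split=> //.
  by rewrite ei eq_sym (negbTE ni') eq_sym (negbTE jn).
- have [-> |_] := eqVneq j' j0; last by rewrite eqxx.
  move=> h _; split; last by rewrite ei' (negbTE ni) (negbTE (mem _ _ (inS _ iS ni) h)).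
  by have [] := mt i i j j (inS _ iS ni) (inS _ iS ni) h h.
- move=> h h'; exact: mt (inS _ iS ni) (inS _ i'S ni') h h'.
Qed.

End Elimination.

(** * Close entries, pivots and the normal form *)

Definition gap (R : realType) (I : finType) (e : R) (J : I -> bar R) : Prop :=
  forall i i', bar_nested (J i) (J i') ->
  e < Num.min `|blo (J i) - blo (J i')| `|bhi (J i) - bhi (J i')|.

Section NormalForm.
Variables (R : realType) (F : fieldType).
Variables (V W : pfunctor R F) (I K : finType).
Variables (J : I -> bar R) (L : K -> bar R) (f : pmor V W).
Variables (e : R) (e0 : 0 <= e) (g : pmor W (pshift V e)).
Hypothesis gf : forall t (h : t <= t + e) x, g t (f t x) = ptr V h x.
Hypothesis fg : forall t (h : t <= t + e) y, f (t + e) (g t y) = ptr W h y.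
Implicit Types (X : gbasis V J) (Y : gbasis W L) (S : {set I}) (T : {set K}).

(** One-sided bounds are enough: at a nonzero entry the bar [C] of [W] precedes the bar [B] of [V],
    so both differences are nonnegative. *)
Definition close (B C : bar R) : bool :=
  (blo B - blo C <= e) && (bhi B - bhi C <= e).

Lemma pshift_dies X Y i j s : bcoord X (g s (Y j s)) i != 0 ->
  bhi (J i) <= bhi (L j) + e.
Proof.
apply: bcoord_dies => t h lt.
(* Times of the shifted module have the form [u + e], and naturality of [g] is applied from [s] to
   [u]. *)
have [u tE] : exists u, t = u + e by exists (t - e); rewrite subrK.
subst t; have su : s <= u by rewrite -(lerD2r e).
have := pmap_nat g su (Y j s); rewrite gb_dies ?linear0; last by rewrite ltrD2r in lt.
move=> /esym <- /=; congr (_ _); congr (ptr _ _ _); exact: Prop_irrelevance.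
Qed.

(** After time [e] the generator [X i] is still alive, so [g] after [f] has coordinate 1 along it.
    Some [j] contributes to this coordinate; its factor in [f] is the entry, and its factor in [g]
    bounds both endpoints of [J i]. *)
Lemma long_dom X Y i : e <= blen (J i) ->
  exists j, gmx X Y f i j != 0 /\ close (J i) (L j).
Proof.
move=> long; set s := blo (J i); have h : s <= s + e by rewrite lerDl.
have it : inbar (J i) (s + e) by rewrite inbarE h /= -lerBrDl.
have E : bcoord X (g s (f s (X i s))) i = \sum_j gmx X Y f i j * bcoord X (g s (Y j s)) i.
  rewrite (gmxE X Y) // linear_sum /=.
  under eq_bigr => j _ do rewrite linearZ /=.
  by rewrite bcoord_linear.
move: E; rewrite (gf h) gb_tr ?lo_inbar // bcoord_gen // eqxx => E.
have [j /andP[nz1 nz2]] : exists j, (gmx X Y f i j != 0) && (bcoord X (g s (Y j s)) i != 0).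
  apply/existsP; apply: contraTT isT => /existsPn nz.
  move/eqP: E; rewrite big1 ?oner_eq0 // => j _; apply/eqP.
  by have := nz j; rewrite negb_and !negbK mulf_eq0.
exists j; split=> //; apply/andP; split; last first.
  by rewrite lerBlDl; exact: pshift_dies nz2.
have [h' E'] := gb_born Y (bcoord_neq0 nz1).
have := nz2; rewrite {1}E' (pmap_nat g) /= => /bcoord_born.
by rewrite lerBlDl.
Qed.

(** The same argument for [f] after [g]. Here the factor in [f] is read at time [s + e], possibly
    after the birth of [J i], and [gmxE] turns it into an entry. *)
Lemma long_cod X Y j : e <= blen (L j) ->
  exists i, gmx X Y f i j != 0 /\ close (J i) (L j).
Proof.
move=> long; set s := blo (L j); have h : s <= s + e by rewrite lerDl.
have it : inbar (L j) (s + e) by rewrite inbarE h /= -lerBrDl.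
have E : bcoord Y (f (s + e) (g s (Y j s))) j =
    \sum_i bcoord X (g s (Y j s)) i * bcoord Y (f (s + e) (X i (s + e))) j.
  rewrite [in LHS](bcoordE X (g s (Y j s))) linear_sum /=.
  under eq_bigr => i _ do rewrite linearZ /=.
  by rewrite bcoord_linear.
move: E; rewrite (fg h) gb_tr ?lo_inbar // bcoord_gen // eqxx => E.
have [i /andP[nz1 nz2]] : exists i, (bcoord X (g s (Y j s)) i != 0) &&
    (bcoord Y (f (s + e) (X i (s + e))) j != 0).
  apply/existsP; apply: contraTT isT => /existsPn nz.
  move/eqP: E; rewrite big1 ?oner_eq0 // => i _; apply/eqP.
  by have := nz i; rewrite negb_and !negbK mulf_eq0.
have := bcoord_neq0 nz1; rewrite inbarE => /andP[lo _].
exists i; split.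
  by move: nz2; rewrite (gmxE X Y) // bcoord_sum it.
apply/andP; split; first by rewrite lerBlDl.
by rewrite lerBlDl; exact: pshift_dies nz1.
Qed.

(** A long bar in the row or the column of the given entry supplies a close one, and the block shape
    keeps it outside [S]. *)
Lemma close_entry X Y S T i j : resolved f X Y S T -> i \notin S ->
  gmx X Y f i j != 0 ->
  exists i' j', [/\ i' \notin S, gmx X Y f i' j' != 0 & close (J i') (L j')].
Proof.
move=> [bl _] iS nz.
have [/(long_dom X Y)[j' []]|si] := leP e (blen (J i)); first by exists i, j'.
have [/(long_cod X Y)[i' [nz' c]]|sj] := leP e (blen (L j)).
  by exists i', j; split; rewrite // (bl _ _ nz') -(bl _ _ nz).
(* Both bars are shorter than [e] and, by precedence, they meet; so each difference of endpoints is
   at most one of the two lengths. *)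
exists i, j; split => //.
move: (gmx_prec nz) si sj; rewrite /close /bar_prec /blen => /and3P[*].
by apply/andP; split; lra.
Qed.

Lemma gapP (T : finType) (B : T -> bar R) i i' : gap e B ->
  blo (B i') < blo (B i) -> bhi (B i) < bhi (B i') ->
  e < blo (B i) - blo (B i') /\ e < bhi (B i') - bhi (B i).
Proof.
move=> gapB lo hi; have := gapB i i'; rewrite /bar_nested lo hi lt_min => /(_ isT).
by rewrite gtr0_norm ?subr_gt0 // ltr0_norm ?subr_lt0 // opprB => /andP.
Qed.

Lemma pivot X Y S T i j : gap e J -> gap e L -> resolved f X Y S T ->
  i \notin S -> gmx X Y f i j != 0 -> exists i0 j0, [/\ i0 \notin S,
    gmx X Y f i0 j0 != 0,
    forall j, gmx X Y f i0 j != 0 -> bar_prec (L j) (L j0) &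
    forall i, gmx X Y f i j0 != 0 -> bar_prec (J i0) (J i)].
Proof.
move=> gapJ gapL res iS nz; have [bl _] := res.
have [i1 [j1 [i1S nz1 c1]]] := close_entry res iS nz.
pose P (p : I * K) := [&& p.1 \notin S, gmx X Y f p.1 p.2 != 0 & close (J p.1) (L p.2)].
(* At a nonzero entry this is the sum of the two nonnegative endpoint distances. *)
pose D (p : I * K) := (blo (J p.1) + bhi (J p.1)) - (blo (L p.2) + bhi (L p.2)).
have P1 : P (i1, j1) by apply/and3P.
case: (arg_minP (P := P) D P1) => -[i0 j0] /and3P /= [i0S nz0 /andP[c2 c3]] minD.
exists i0, j0; split => // [k nzk|k nzk].
- have /and3P[k1 k2 k3] := gmx_prec nzk; have /and3P[l1 l2 l3] := gmx_prec nz0.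
  apply/and3P; split; last 1 first.
  (* Otherwise either [L j0] is nested in [L k], with right endpoints at most [e] apart because both
     lie within [e] below that of [J i0], or the entry [(i0, k)] is close with a smaller [D]. *)
  + rewrite leNgt; apply/negP => hi.
    have [lo|lo] := ltP (blo (L k)) (blo (L j0)).
      by have [_] := gapP gapL lo hi; lra.
    have := minD (i0, k); rewrite /P /D /= i0S nzk /close.
    have -> : blo (J i0) - blo (L k) <= e by lra.
    have -> : bhi (J i0) - bhi (L k) <= e by lra.
    by move=> /(_ isT); lra.
  + rewrite leNgt; apply/negP => lo.
    have [hi|hi] := ltP (bhi (L k)) (bhi (L j0)).
      by have [+ _] := gapP gapL lo hi; lra.
    have := minD (i0, k); rewrite /P /D /= i0S nzk /close.
    have -> : blo (J i0) - blo (L k) <= e by lra.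
    have -> : bhi (J i0) - bhi (L k) <= e by lra.
    by move=> /(_ isT); lra.
  + by lra.
(* The column is treated like the row, with nesting now among the bars of [V]. *)
- have /and3P[k1 k2 k3] := gmx_prec nzk; have /and3P[l1 l2 l3] := gmx_prec nz0.
  have kS : k \notin S by rewrite (bl _ _ nzk) -(bl _ _ nz0).
  apply/and3P; split; last 1 first.
  + rewrite leNgt; apply/negP => hi.
    have [lo|lo] := ltP (blo (J i0)) (blo (J k)).
      by have [_] := gapP gapJ lo hi; lra.
    have := minD (k, j0); rewrite /P /D /= kS nzk /close.
    have -> : blo (J k) - blo (L j0) <= e by lra.
    have -> : bhi (J k) - bhi (L j0) <= e by lra.
    by move=> /(_ isT); lra.
  + rewrite leNgt; apply/negP => lo.
    have [hi|hi] := ltP (bhi (J i0)) (bhi (J k)).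
      by have [+ _] := gapP gapJ lo hi; lra.
    have := minD (k, j0); rewrite /P /D /= kS nzk /close.
    have -> : blo (J k) - blo (L j0) <= e by lra.
    have -> : bhi (J k) - bhi (L j0) <= e by lra.
    by move=> /(_ isT); lra.
  + by lra.
Qed.

Lemma normal_form X Y : gap e J -> gap e L ->
  exists (X' : gbasis V J) (Y' : gbasis W L), matching f X' Y'.
Proof.
move=> gapJ gapL.
(* Induction on the number of rows not yet resolved. The base changes keep the indexed bars, so both
   gap hypotheses persist. *)
suff H n S T X' Y' : (#|~: S| <= n)%N -> resolved f X' Y' S T ->
    exists (X : gbasis V J) (Y : gbasis W L), matching f X Y.
  apply: (H _ set0 set0 X Y (leqnn _)).
  by split=> [i j _|i i' j j']; rewrite !inE.
elim: n S T X' Y' => [|n IH] S T X' Y' Sn res.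
  exists X', Y' => i i' j j'; apply: res.2; apply: contraTT Sn => iS.
    by rewrite -ltnNge; apply/card_gt0P; exists i; rewrite inE.
  by rewrite -ltnNge; apply/card_gt0P; exists i'; rewrite inE.
have [/existsP[i /existsP[j /andP[iS nz]]]|/existsPn none] :=
    boolP [exists i, exists j, (i \notin S) && (gmx X' Y' f i j != 0)].
  have [i0 [j0 [i0S nz0 col row]]] := pivot gapJ gapL res iS nz.
  have [X'' [Y'' res']] := resolve_pivot res i0S nz0 col row.
  apply: IH res'; rewrite -ltnS; apply: leq_trans Sn.
  apply/proper_card/properP; split; first by rewrite setCS subsetUr.
  by exists i0; rewrite !inE ?eqxx.
exists X', Y' => i i' j j' nz nz'; apply: res.2 => //.
  by have /existsPn/(_ j) := none i; rewrite nz andbT negbK.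
by have /existsPn/(_ j') := none i'; rewrite nz' andbT negbK.
Qed.
End NormalForm.

(** * Barcode bases of interval sums *)

Section GenList.
Variables (R : realType) (F : fieldType).
Implicit Types (U V W : pfunctor R F).

Definition gens V (I : finType) (J : I -> bar R) (x : I -> forall t, V t) (r : seq I) :
  seq (bargen V) := [seq BarGen (J i) (x i) | i <- r].

(* A list of bar generators that enumerates a barcode basis, with no reference
   to a chosen barcode of V. *)
Definition gen_list V (B : seq (bargen V)) : Prop :=
  exists (I : finType) (J : I -> bar R) (X : gbasis V J) (r : seq I),
    perm_eq r (enum I) /\ B = gens J X r.

Lemma gbasis_iso U V (g : pmor U V) (I : finType) (J : I -> bar R)
    (X : gbasis U J) : (forall t, bijective (g t)) ->
  exists Y : gbasis V J, forall i, Y i = fun t => g t (X i t).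
Proof.
move=> bij.
suff H : is_gbasis J (fun i t => g t (X i t)) by exists (GBasis H).
have gsum t (c : I -> F) : g t (\sum_i c i *: X i t) = \sum_i c i *: g t (X i t).
  by rewrite linear_sum; apply: eq_bigr => i _; rewrite linearZ.
split.
- by move=> i t it; rewrite gb_out ?linear0.
- by move=> i s t h si; rewrite -pmap_nat gb_tr.
- move=> t c c0; rewrite -gsum => s0; apply: (gb_free (X := X) c0).
  by apply: (bij_inj (bij t)); rewrite s0 linear0.
- move=> t v; have [k _ gK] := bij t; have [c e] := gb_span X (k v).
  by exists c; rewrite -gsum -e gK.
Qed.

Lemma gens_gmap U V (g : pmor U V) (I : finType) (J : I -> bar R) x r :
  map (gmap g) (gens J x r) = gens J (fun i t => g t (x i t)) r.
Proof. by rewrite -map_comp. Qed.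

Lemma gen_list_iso U V (g : pmor U V) (B : seq (bargen U)) :
  (forall t, bijective (g t)) -> gen_list B -> gen_list (map (gmap g) B).
Proof.
move=> bij [I [J [X [r [rI ->]]]]]; have [Y YE] := gbasis_iso X bij.
exists I, J, Y, r; split=> //; rewrite gens_gmap.
by congr gens; apply: funext => i; rewrite YE.
Qed.

Lemma gen_list_pzero : gen_list (V := pzero R F) [::].
Proof.
have H : @is_gbasis R F (pzero R F) void (of_void (bar R)) (fun _ _ => 0).
  split; [by case | by case | by move=> t c _ _ [] |].
  move=> t v; exists (fun=> 0); rewrite big_pred0; last by case.
  exact: thinmx0.
exists void, (of_void (bar R)), (GBasis H), [::]; split=> //.
by rewrite enumT unlock.
Qed.

Lemma gen_list_kmod (J : bar R) : gen_list [:: kgen F J].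
Proof.
pose x (i : unit) t : kmod F J t := const_mx 1.
suff H : is_gbasis (fun=> J) x.
  exists unit, (fun=> J), (GBasis H), [:: tt].
  by rewrite enumT unlock.
have sumu t (c : unit -> F) : \sum_i c i *: x i t = c tt *: x tt t.
  by rewrite (bigD1 tt) //= big1 ?addr0 // => -[].
rewrite /is_gbasis /x /=; split.
- move=> _ t; case: inbar => // _; exact: thinmx0.
- by move=> _ s t h si; apply: (@const_mx1M F true) => _ _.
- move=> t c c0; rewrite sumu => s0 [].
  have [it|/c0 //] := boolP (inbar J t).
  move/matrixP: s0; rewrite /x /=; move: it; case: inbar => // _ /(_ ord0 ord0).
  by rewrite !mxE mulr1.
(* This sum is the only coordinate inside the bar and 0 outside, where the space has dimension 0. *)
- move=> t v; exists (fun=> \sum_k v ord0 k); rewrite sumu /x /=.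
  move: v => /=; case: inbar => /= v; last by rewrite [LHS]thinmx0 [RHS]thinmx0.
  by apply/matrixP => i j; rewrite big_ord1 !mxE mulr1 !ord1.
Qed.

Lemma pairE V W t (u : psum V W t) : u = pinl V W t u.1 + pinr V W t u.2.
Proof. by case: u => a b; congr pair; rewrite /= ?addr0 ?add0r. Qed.

Lemma gen_list_psum V W (B : seq (bargen V)) (C : seq (bargen W)) :
  gen_list B -> gen_list C ->
  gen_list (map (gmap (pinl V W)) B ++ map (gmap (pinr V W)) C).
Proof.
move=> [I [J [X [r [rI ->]]]]] [K [L [Y [q [qK ->]]]]].
pose M (k : I + K) := match k with inl i => J i | inr j => L j end.
pose x (k : I + K) t : psum V W t :=
  match k with inl i => pinl V W t (X i t) | inr j => pinr V W t (Y j t) end.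
have xsum t (c : I + K -> F) : \sum_k c k *: x k t =
    pinl V W t (\sum_i c (inl i) *: X i t) + pinr V W t (\sum_j c (inr j) *: Y j t).
  rewrite big_sumType !linear_sum; congr (_ + _); apply: eq_bigr => i _;
  by rewrite linearZ.
suff H : is_gbasis M x.
  exists (I + K)%type, M, (GBasis H), (map inl r ++ map inr q); split.
    rewrite enumT unlock /= /sum_enum -!enumT.
    by apply: perm_cat; apply: perm_map.
  by rewrite !gens_gmap /gens map_cat -!map_comp.
split.
- by move=> [i|j] t it /=; rewrite gb_out // linear0.
- by move=> [i|j] s t h si; rewrite -pmap_nat gb_tr.
- move=> t c c0; rewrite xsum => s0.
  have e1 : \sum_i c (inl i) *: X i t = 0.
    by have := congr1 fst s0; rewrite /= addr0.
  have e2 : \sum_j c (inr j) *: Y j t = 0.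
    by have := congr1 snd s0; rewrite /= add0r.
  case=> [i|j].
    exact: (gb_free (X := X) (fun i => c0 (inl i)) e1).
  exact: (gb_free (X := Y) (fun j => c0 (inr j)) e2).
- move=> t v; have [c1 e1] := gb_span X v.1; have [c2 e2] := gb_span Y v.2.
  exists (fun k => match k with inl i => c1 i | inr j => c2 j end).
  by rewrite xsum /= -e1 -e2 -pairE.
Qed.

Lemma gen_list_dom (L : seq (lsummand R)) : gen_list (sum_dom_gens F L).
Proof.
elim: L => [|l L IH] /=; first exact: gen_list_pzero.
apply: gen_list_psum IH.
by case: l => [J1 J2 h|J|J] /=; first [exact: gen_list_kmod | exact: gen_list_pzero].
Qed.

Lemma gen_list_cod (L : seq (lsummand R)) : gen_list (sum_cod_gens F L).
Proof.
elim: L => [|l L IH] /=; first exact: gen_list_pzero.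
apply: gen_list_psum IH.
by case: l => [J1 J2 h|J|J] /=; first [exact: gen_list_kmod | exact: gen_list_pzero].
Qed.

Lemma gen_list_kmod_sum (s : seq (bar R)) : exists B : seq (bargen (kmod_sum F s)),
  gen_list B /\ map (@gbar _ _ _) B = s.
Proof.
elim: s => [|J s [B [gB sB]]] /=; first by exists [::]; split=> //; exact: gen_list_pzero.
have := gen_list_psum (gen_list_kmod J) gB; set C := _ ++ _ => gC.
by exists C; split=> //; rewrite /= -map_comp -[in RHS]sB.
Qed.

Lemma gens_bars V (I : finType) (J : I -> bar R) x r :
  map (@gbar _ _ V) (gens J x r) = map J r.
Proof. by rewrite -map_comp. Qed.

Lemma piso_bij U V (D : piso U V) :
  (forall t, bijective (fwd D t)) /\ (forall t, bijective (bwd D t)).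
Proof.
split=> t; first by exists (bwd D t); [apply: fwdK|apply: bwdK].
by exists (fwd D t); [apply: bwdK|apply: fwdK].
Qed.

Lemma pmod_gens (V : pmod R F) : exists B : seq (bargen V),
  gen_list B /\ map (@gbar _ _ _) B = Bar V.
Proof.
have [D] : inhabited (piso V (kmod_sum F (Bar V))) by rewrite /Bar; case: cid.
have [B [gB sB]] := gen_list_kmod_sum (Bar V).
exists (map (gmap (bwd D)) B); split; first exact: gen_list_iso (piso_bij D).2 gB.
by rewrite -map_comp -[RHS]sB.
Qed.

Lemma pmod_gbasis (V : pmod R F) : exists (I : finType) (J : I -> bar R)
  (X : gbasis V J), perm_eq (map J (enum I)) (Bar V).
Proof.
have [B [[I [J [X [r [rI e]]]]] <-]] := pmod_gens V.
exists I, J, X; rewrite e gens_bars; apply: perm_map; by rewrite perm_sym.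
Qed.

(** Coefficients on [nat] avoid the index type ['I_(size e)], which depends on the list and
    obstructs rewriting it. *)
Lemma is_basisP (E : lmodType F) (e : seq E) : is_basis e <->
  (forall c : nat -> F, \sum_(i < size e) c i *: e`_i = 0 ->
     forall i, (i < size e)%N -> c i = 0) /\
  (forall v, exists c : nat -> F, v = \sum_(i < size e) c i *: e`_i).
Proof.
have ext (c : 'I_(size e) -> F) : exists d : nat -> F, c = fun i : 'I__ => d i.
  exists (fun i => if insub i is Some k then c k else 0).
  by apply: funext => i; rewrite valK.
split=> -[fr sp]; split.
- by move=> c s0 i h; apply: (fr (fun i : 'I__ => c i) s0 (Ordinal h)).
- by move=> v; have [c ->] := sp v; have [d ->] := ext c; exists d.
- by move=> c; have [d ->] := ext c => /fr h i; apply: h.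
- by move=> v; have [c ->] := sp v; exists (fun i : 'I__ => c i).
Qed.

Lemma vecs_at_gens V (I : finType) (J : I -> bar R) (x : I -> forall t, V t) r t :
  vecs_at (gens J x r) t = [seq x i t | i <- r & inbar (J i) t].
Proof. by rewrite /vecs_at /gens filter_map -map_comp. Qed.

Lemma gen_list_basis V (B : seq (bargen V)) t : gen_list B -> is_basis (vecs_at B t).
Proof.
move=> [I [J [X [r [rI ->]]]]]; rewrite vecs_at_gens.
set q := [seq i <- r | _]; apply/is_basisP; rewrite size_map.
have uq : uniq q by rewrite filter_uniq // (perm_uniq rI) enum_uniq.
have memq i : (i \in q) = inbar (J i) t.
  by rewrite mem_filter (perm_mem rI) mem_enum inE andbT.
have sumq (c : I -> F) : (forall i, ~~ inbar (J i) t -> c i = 0) ->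
    \sum_i c i *: X i t = \sum_(i <- q) c i *: X i t.
  move=> c0; rewrite big_filter (perm_big _ rI) big_enum_cond /=.
  rewrite [LHS](bigID (fun i => inbar (J i) t)) /= [X in _ + X]big1 ?addr0 // => i /c0 ->.
  by rewrite scale0r.
have sumn (c : I -> F) d : (forall i, i \in q -> d (index i q) = c i) ->
    \sum_(i <- q) c i *: X i t = \sum_(i < size q) d i *: [seq X i t | i <- q]`_i.
  case: (q) uq => [|i0 q'] uq' dE; first by rewrite big_nil big_ord0.
  rewrite (big_nth i0) big_mkord; apply: eq_bigr => i _.
  by rewrite (nth_map i0) // -dE ?mem_nth // index_uniq.
split.
- move=> d.
  pose c i := if inbar (J i) t then d (index i q) else 0.
  rewrite -(sumn c) => [|i]; last by rewrite memq /c => ->.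
  have c0 i : ~~ inbar (J i) t -> c i = 0 by rewrite /c => /negbTE ->.
  rewrite -sumq // => /(gb_free c0) cz i hi.
  (* [nth] takes a default from [q] itself; an empty [q] has no position to treat. *)
  have [i0 _|] := pickP (mem q); last first.
    by move=> h; case: (q) hi h => // a l _ /(_ a); rewrite /= inE eqxx.
  have := cz (nth i0 q i); rewrite /c -memq mem_nth // index_uniq //.
- move=> v; exists (fun n => nth 0 [seq bcoord X v i | i <- q] n).
  rewrite -(sumn (bcoord X v)) -?sumq -?bcoordE // => [i|i iq].
    exact: bcoord_out.
  by rewrite (nth_map i) ?index_mem // nth_index.
Qed.

Lemma gen_list_barcode (V : pmod R F) (B : seq (bargen V)) : gen_list B -> barcode_basis B.
Proof.
move=> gB; have [I [J [X [r [rI BE]]]]] := gB.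
have al (P : pred (bargen V)) : (forall i, P (BarGen (J i) (X i))) ->
    forall i : 'I_(size B), P (tnth (in_tuple B) i).
  move=> PX; apply/all_tnthP; rewrite BE /= /gens all_map; apply/allP => i _ /=; exact: PX.
split.
- have [K [L [Y e]]] := pmod_gbasis V.
  rewrite BE gens_bars; apply: perm_trans e; apply: perm_trans (gbasis_bars X Y).
  exact: perm_map.
- by move=> t; apply: gen_list_basis.
(* [al] is about boolean predicates, so the law is reflected into one before being checked on the
   members of [B]. *)
- move=> i; apply/asboolP; move: i.
  apply: (al (fun x => `[< forall t : R, ~~ inbar (gbar x) t -> gvec x t = 0 >])) => i.
  by apply/asboolP => t /=; apply: gb_out.
- move=> i; apply/asboolP; move: i.
  apply: (al (fun x => `[< forall (s t : R) (h : s <= t), inbar (gbar x) s ->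
          ptr V h (gvec x s) = gvec x t >])) => i.
  by apply/asboolP => s t h /=; apply: gb_tr.
Qed.

End GenList.

(** * Invertibility of the truncated morphisms *)

Section Retract.
Variables (R : realType) (F : fieldType).
Implicit Types (U V W : pfunctor R F).

Lemma ptr_comp_eq V s t t' u (h1 : s <= t) (h2 : t <= u) (h3 : s <= t') (h4 : t' <= u) x :
  ptr V h2 (ptr V h1 x) = ptr V h4 (ptr V h3 x).
Proof. by rewrite !(ptr_comp _ _ (le_trans h1 h2)). Qed.

(** A retract up to waiting time [q]. Both truncations and identities are instances, so one argument
    covers the three truncated morphisms. *)
Record almost_retract (q : R) V V' (p : pmor V V') (i : pmor V' V) : Prop := {
  ar_proj : forall t x, p t (i t x) = x;
  ar_close : forall s t (h : s <= t), q <= t - s ->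
    forall x, ptr V h (i s (p s x)) = ptr V h x }.

(** The new inverse waits for an extra time [q] after [Psi]; this wait absorbs the defect of [iW]
    after [pW] in one relation and that of [iV] after [pV] in the other. *)
Lemma invertible_retract (V W V' W' : pfunctor R F) (Phi : pmor V W) (f : pmor V' W')
    (d q : R) (pV : pmor V V') (iV : pmor V' V) (pW : pmor W W') (iW : pmor W' W) :
  0 <= q -> almost_retract q pV iV -> almost_retract q pW iW ->
  (forall t x, f t x = pW t (Phi t (iV t x))) ->
  invertible d Phi -> invertible (d + q / 2) f.
Proof.
move=> q0 [pVi cV] [pWi cW] fE [d0 [Psi PsiP]].
have e0 : 0 <= d + q / 2 by lra.
split=> //.
have h t : t + 2 * d <= t + 2 * (d + q / 2) by lra.
have nat s t (st : s <= t) (y : W' s) :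
    (pV _ \o ptr V (h t) \o Psi t \o iW t : {linear W' t -> V' _}) (ptr W' st y) =
    ptr (pshift V' (2 * (d + q / 2))) st
    ((pV _ \o ptr V (h s) \o Psi s \o iW s : {linear W' s -> V' _}) y).
  rewrite /= (pmap_nat iW) (pmap_nat Psi) /= -(pmap_nat pV); congr (pV _ _).
  exact: ptr_comp_eq.
exists (@PMor _ _ W' (pshift V' (2 * (d + q / 2)))
  (fun t => pV _ \o ptr V (h t) \o Psi t \o iW t : {linear W' t -> V' _}) nat).
move=> t k /=; have k2 : t <= t + 2 * d by lra.
have [gf fg] := PsiP t k2; split=> [x|y].
  (* By naturality of [Psi] the wait moves into [W], where it cancels [iW] after [pW]. *)
  have tq : t <= t + q by lra.
  have tq2 : t + 2 * d <= t + q + 2 * d by lra.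
  have le : t + q + 2 * d <= t + 2 * (d + q / 2) by lra.
  have E w : ptr V (h t) (Psi t w) = ptr V le (Psi (t + q) (ptr W tq w)).
    rewrite (pmap_nat Psi) /=; symmetry; exact: ptr_comp.
  rewrite fE E cW -?E; last by lra.
  by rewrite gf (ptr_comp _ _ k) pmap_nat pVi.
(* Here the wait stays in [V] and cancels [iV] after [pV]. *)
rewrite fE (pmap_nat pV) (pmap_nat iV) cV; last by lra.
rewrite (pmap_nat Phi) fg (ptr_comp _ _ k) pmap_nat pWi //.
Qed.

(** The identity and [in_ge] after [pr_ge] differ by the short summand, all of whose generators die
    in less than time [q]. *)
Lemma retract_ge q (V : pmod R F) (S : qsplitting q V) :
  almost_retract q (pr_ge S) (in_ge S).
Proof.
split=> [t x|s t h st x]; first by rewrite /= bwdK.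
have [K [L [Y e]]] := pmod_gbasis (qlt S).
have z0 z : ptr (qlt S) h z = 0.
  rewrite (bcoordE Y z) linear_sum big1 // => j _; rewrite linearZ /=.
  have [->|/bcoord_neq0] := eqVneq (bcoord Y z j) 0; first by rewrite scale0r.
  rewrite inbarE => /andP[lo _]; rewrite gb_dies ?scaler0 //.
  have : L j \in Bar (qlt S) by rewrite -(perm_mem e) map_f ?mem_enum.
  by move/(allP (qltP S)); rewrite /blen; lra.
apply: (can_inj (fwdK (qiso S) (t := t))).
rewrite !pmap_nat /= bwdK; congr pair.
by rewrite linear0 z0.
Qed.

End Retract.

(** * Ladder decompositions *)

Section Ladder.
Variables (R : realType) (F : fieldType).
Implicit Types (U V W : pfunctor R F).

(* The coordinate of a vector of k_J, for n = 1 inside J and n = 0 outside. *)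
Definition vsum n (r : 'rV[F]_n) : F := \sum_k r ord0 k.

Lemma vsum_mul1 (a b : bool) (r : 'rV[F]_a) :
  vsum (r *m (const_mx 1 : 'M_(a, b))) = if b then vsum r else 0.
Proof.
rewrite /vsum; case: b => /=; last by rewrite big_ord0.
by rewrite big_ord1 mxE; apply: eq_bigr => i _; rewrite mxE mulr1.
Qed.

Lemma vsum0 (a : bool) (r : 'rV[F]_a) : ~~ a -> vsum r = 0.
Proof. by case: a r => // r _; rewrite /vsum big_ord0. Qed.

Lemma vsum_const1 (a : bool) : vsum (const_mx 1 : 'rV[F]_a) = a%:R.
Proof. by case: a; rewrite /vsum ?big_ord0 // big_ord1 mxE. Qed.

Lemma kmor_ex V (J : bar R) (x : forall t, V t) :
  (forall t, ~~ inbar J t -> x t = 0) ->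
  (forall s t (h : s <= t), inbar J s -> ptr V h (x s) = x t) ->
  exists g : pmor (kmod F J) V, forall t r, g t r = vsum r *: x t.
Proof.
move=> out tr.
have lin t : linear (fun r : kmod F J t => vsum r *: x t).
  move=> a u v; rewrite scalerA -scalerDl /vsum mulr_sumr -big_split /=.
  by congr (_ *: _); apply: eq_bigr => k _; rewrite !mxE.
suff nat s t (h : s <= t) r : mk_linear (lin t) (ptr (kmod F J) h r) =
    ptr V h (mk_linear (lin s) r).
  by exists (PMor nat).
rewrite /= linearZ /= (@vsum_mul1 (inbar J s) (inbar J t) r).
have [si|si] := orP (orbN (inbar J s)); last by rewrite vsum0 // if_same !scale0r.
by rewrite tr //; case: ifPn => // /out ->; rewrite !scaler0.
Qed.

Lemma copair_ex U U' V (g : pmor U V) (g' : pmor U' V) :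
  exists h : pmor (psum U U') V, forall t u, h t u = g t u.1 + g' t u.2.
Proof.
have lin t : linear (fun u : psum U U' t => g t u.1 + g' t u.2).
  by move=> a u v; rewrite !linearP scalerDr addrACA.
suff nat s t (h : s <= t) u : mk_linear (lin t) (ptr (psum U U') h u) =
    ptr V h (mk_linear (lin s) u).
  by exists (PMor nat).
by rewrite /= linearD !pmap_nat.
Qed.

Variables (V W : pfunctor R F) (f : pmor V W).
Variables (I K : finType) (J : I -> bar R) (L : K -> bar R).
Variables (X : gbasis V J) (Y : gbasis W L).

(** A morphism of ladders from an interval sum to [f], built one summand at a time. It is an
    isomorphism as soon as [bv] and [bw] enumerate bases. *)
Definition realizes (M : seq (lsummand R)) (bv : seq (bargen V)) (bw : seq (bargen W)) :=
  exists (g : pmor (ldom (lmodule_sum F M)) V) (h : pmor (lcod (lmodule_sum F M)) W),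
  [/\ forall t x, h t (lmor (lmodule_sum F M) t x) = f t (g t x),
      map (gmap g) (sum_dom_gens F M) = bv &
      map (gmap h) (sum_cod_gens F M) = bw].

Lemma realizes_nil : realizes [::] [::] [::].
Proof.
exists (pzeromor (pzero R F) V), (pzeromor (pzero R F) W); split => //= t x.
by rewrite linear0.
Qed.

Lemma realizes_cons l M bv bw (g : pmor (ldom (lmodule F l)) V)
    (h : pmor (lcod (lmodule F l)) W) :
  (forall t x, h t (lmor (lmodule F l) t x) = f t (g t x)) ->
  realizes M bv bw ->
  realizes (l :: M) (map (gmap g) (lsummand_dom_gens F l) ++ bv)
                    (map (gmap h) (lsummand_cod_gens F l) ++ bw).
Proof.
move=> gh [g' [h' [gh' <- <-]]].
have [G GE] := copair_ex g g'; have [H HE] := copair_ex h h'.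
exists G, H; split=> /= [t x||].
- by rewrite GE HE linearD -gh -gh'.
- rewrite map_cat -!map_comp; congr (_ ++ _); apply: eq_map => -[b x]; congr BarGen;
  by apply: functional_extensionality_dep => t /=; rewrite GE /= linear0 ?addr0 ?add0r.
- rewrite map_cat -!map_comp; congr (_ ++ _); apply: eq_map => -[b x]; congr BarGen;
  by apply: functional_extensionality_dep => t /=; rewrite HE /= linear0 ?addr0 ?add0r.
Qed.

Lemma gmap_kgen U (T : finType) (B : T -> bar R) (Z : gbasis U B) k
    (g : pmor (kmod F (B k)) U) : (forall t r, g t r = vsum r *: Z k t) ->
  gmap g (kgen F (B k)) = BarGen (B k) (Z k).
Proof.
move=> gE; congr BarGen; apply: functional_extensionality_dep => t /=.
rewrite gE vsum_const1; have [it|it] := orP (orbN (inbar (B k) t)); first by rewrite it scale1r.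
by rewrite gb_out // scaler0.
Qed.

Lemma gbasis_kmor U (T : finType) (B : T -> bar R) (Z : gbasis U B) k :
  exists g : pmor (kmod F (B k)) U, forall t r, g t r = vsum r *: Z k t.
Proof. by apply: kmor_ex => [t|s t h]; [apply: gb_out | apply: gb_tr]. Qed.

Lemma realizes_minus j M bv bw : realizes M bv bw ->
  realizes (LIminus (L j) :: M) bv (BarGen (L j) (Y j) :: bw).
Proof.
have [h hE] := gbasis_kmor Y j.
move=> /(@realizes_cons (LIminus (L j)) _ _ _ (pzeromor (pzero R F) V) h) /=.
by rewrite (gmap_kgen hE); apply => t x; rewrite !linear0.
Qed.

Lemma realizes_plus i M bv bw : (forall j, gmx X Y f i j = 0) -> realizes M bv bw ->
  realizes (LIplus (J i) :: M) (BarGen (J i) (X i) :: bv) bw.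
Proof.
move=> A0; have [g gE] := gbasis_kmor X i.
move=> /(@realizes_cons (LIplus (J i)) _ _ _ g (pzeromor (pzero R F) W)) /=.
rewrite (gmap_kgen gE); apply => t x; rewrite gE linearZ /=.
have [it|it] := orP (orbN (inbar (J i) t)); last by rewrite vsum0 ?scale0r.
have lo : blo (J i) <= t by move: it; rewrite inbarE => /andP[].
by rewrite (gmxE X Y) // big1 ?scaler0 // => j _; rewrite A0 scale0r.
Qed.

Lemma realizes_R i j M bv bw : bar_prec (L j) (J i) ->
  (forall k, gmx X Y f i k = (k == j)%:R) -> realizes M bv bw ->
  exists l, realizes (l :: M) (BarGen (J i) (X i) :: bv) (BarGen (L j) (Y j) :: bw).
Proof.
move=> prec A0; have [g gE] := gbasis_kmor X i; have [h hE] := gbasis_kmor Y j.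
move=> /(@realizes_cons (LR prec) _ _ _ g h) /=.
rewrite (gmap_kgen gE) (gmap_kgen hE) => H; exists (LR prec); apply: H => t x.
rewrite gE hE /= (@vsum_mul1 (inbar (J i) t) (inbar (L j) t) x) linearZ /=.
have [it|it] := orP (orbN (inbar (J i) t)); last by rewrite vsum0 // if_same !scale0r.
have lo : blo (J i) <= t by move: it; rewrite inbarE => /andP[].
rewrite (gmxE X Y) // (bigD1 j) //= A0 eqxx scale1r big1 ?addr0; last first.
  by move=> k /negbTE kj; rewrite A0 kj scale0r.
by case: ifPn => // jt; rewrite gb_out // !scaler0.
Qed.

Hypothesis mt : matching f X Y.

Lemma realizes_gens : exists M r q, [/\ perm_eq r (enum I), perm_eq q (enum K) &
  realizes M (gens J X r) (gens L Y q)].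
Proof.
(* The partial matching from rows to columns given by the nonzero entries. *)
pose mu i := [pick j | gmx X Y f i j != 0].
have mu_inj i i' j : mu i = Some j -> mu i' = Some j -> i = i'.
  rewrite /mu; case: pickP => // k nz [<-]; case: pickP => // k' nz' [e].
  by have [_] := mt nz nz'; rewrite -e eqxx => /eqP.
have base q : exists M, realizes M [::] (gens L Y q).
  elim: q => [|j q [M IH]]; first by exists [::]; exact: realizes_nil.
  by exists (LIminus (L j) :: M); apply: realizes_minus.
have [M0 b0] := base [seq j <- enum K | j \notin pmap mu (enum I)].
(* The list [q] is meant for the unmatched columns, which become [LIminus] summands; each row then
   puts its matched column, if any, in front. *)
have step q r : exists M, realizes M (gens J X r) (gens L Y (pmap mu r ++ q)).
  elim: r => [|i r [M IH]] /=; first exact: base.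
  case E: (mu i) => [j|] /=.
    have Aij k : gmx X Y f i k = (k == j)%:R.
      move: E; rewrite /mu; case: pickP => // j' nz [e]; rewrite e in nz.
      have [->|kj] := eqVneq k j; first by have [] := mt nz nz.
      apply/eqP; apply: contraNT kj => nz'; have [_] := mt nz nz'.
      by rewrite eqxx eq_sym => <-.
    have prec : bar_prec (L j) (J i).
      by apply: (@gmx_prec _ _ _ _ _ _ _ _ X Y f); rewrite Aij eqxx oner_eq0.
    by have [l] := realizes_R prec Aij IH; exists (l :: M).
  exists (LIplus (J i) :: M); apply: realizes_plus IH => j.
  move: E; rewrite /mu; case: pickP => // none _.
  by have /negbFE/eqP := none j.
have [M H] := step [seq j <- enum K | j \notin pmap mu (enum I)] (enum I).
exists M, (enum I); eexists; split; last exact: H; first exact: perm_refl.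
have uq (r : seq I) : uniq r -> uniq (pmap mu r).
  elim: r => //= i r IH /andP[ir ur]; case E: (mu i) => [j|] /=; last exact: IH.
  rewrite IH // andbT mem_pmap; apply: contra ir => /mapP[i' i'r e].
  by rewrite (mu_inj _ _ _ E (esym e)).
apply: uniq_perm; rewrite ?enum_uniq //.
  rewrite cat_uniq uq ?enum_uniq // filter_uniq ?enum_uniq // andbT.
  by apply/hasPn => j; rewrite mem_filter => /andP[].
by move=> j; rewrite mem_cat mem_filter mem_enum inE andbT orbN.
Qed.

End Ladder.

(** * From matched bases to ladder decompositions *)

Section Decompose.
Variables (R : realType) (F : fieldType).

Lemma basis_bij (E E' : lmodType F) (g : {linear E -> E'}) (b : seq E) :
  is_basis b -> is_basis (map g b) -> bijective g.
Proof.
move=> /is_basisP[_ sp] /is_basisP[fr sp']; rewrite size_map in fr sp'.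
have gs (c : nat -> F) : g (\sum_(i < size b) c i *: b`_i) =
    \sum_(i < size b) c i *: (map g b)`_i.
  by rewrite linear_sum; apply: eq_bigr => i _; rewrite linearZ /= (nth_map 0).
have gi x : g x = 0 -> x = 0.
  have [c ->] := sp x; rewrite gs => /fr c0.
  by rewrite big1 // => i _; rewrite c0 ?scale0r.
have gS y : exists x, g x = y.
  by have [c ->] := sp' y; exists (\sum_(i < size b) c i *: b`_i).
have gI : injective g.
  by move=> x y e; apply/eqP; rewrite -subr_eq0; apply/eqP/gi; rewrite linearB e subrr.
exists (fun y => sval (cid (gS y))) => x; last by case: cid.
by apply: gI; case: cid.
Qed.

(** Realizations start at the interval sum while [liso] ends there, so [g] becomes the backward
    map. *)
Lemma piso_of_bij (U V : pfunctor R F) (g : pmor U V) : (forall t, bijective (g t)) ->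
  exists D : piso V U, bwd D = g.
Proof.
move=> bij; have ex t : exists k, cancel (g t) k /\ cancel k (g t) by have [k] := bij t; exists k.
pose k t := sval (cid (ex t)).
have kP t : cancel (g t) (k t) /\ cancel (k t) (g t) by rewrite /k; case: cid.
have lin t : linear (k t).
  move=> a u v; apply: (can_inj (kP t).1).
  by rewrite linearP !(kP t).2.
have nat s t (h : s <= t) x : mk_linear (lin t) (ptr V h x) = ptr U h (mk_linear (lin s) x).
  by apply: (can_inj (kP t).1); rewrite pmap_nat /= (kP t).2 (kP s).2.
have H1 t : cancel (PMor nat t) (g t) by move=> x /=; rewrite (kP t).2.
have H2 t : cancel (g t) (PMor nat t) by move=> x /=; rewrite (kP t).1.
by exists (PIso H1 H2).
Qed.

Lemma realizes_decomposable (V W : pfunctor R F) (f : pmor V W) M bv bw :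
  realizes f M bv bw -> gen_list bv -> gen_list bw -> ladder_decomposable f.
Proof.
move=> [g [h [gh gE hE]]] gv gw.
have gbij t : bijective (g t).
  apply: (basis_bij (b := vecs_at (sum_dom_gens F M) t)).
    exact/gen_list_basis/gen_list_dom.
  have := gen_list_basis t gv; rewrite -gE /vecs_at filter_map -!map_comp.
  by [].
have hbij t : bijective (h t).
  apply: (basis_bij (b := vecs_at (sum_cod_gens F M) t)).
    exact/gen_list_basis/gen_list_cod.
  have := gen_list_basis t gw; rewrite -hE /vecs_at filter_map -!map_comp.
  by [].
have [D DE] := piso_of_bij gbij; have [C CE] := piso_of_bij hbij.
exists M; constructor; apply: (@LIso _ _ (Ladder f) (lmodule_sum F M) D C) => t x /=.
apply: (bij_inj (hbij t)); rewrite gh -{1}CE -{1}DE /=.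
by rewrite !fwdK.
Qed.

(** By [gbasis_bars] the bars of any basis occur in [Bar V], so each nested pair contributes a term
    to the minimum [Xi V]. *)
Lemma lt_Xi (V : pmod R F) (e : R) : (e%:E < Xi V)%E ->
  forall (I : finType) (J : I -> bar R) (X : gbasis V J), gap e J.
Proof.
move=> eX I J X i i' nest.
have [K [L [Y pe]]] := pmod_gbasis V.
have bJ k : J k \in Bar V.
  by rewrite -(perm_mem pe) -(perm_mem (gbasis_bars X Y)) map_f ?mem_enum.
rewrite -lte_fin; apply: lt_le_trans eX _; rewrite /Xi.
rewrite (big_rem (J i)) ?bJ //= ge_min; apply/orP; left.
by rewrite (big_rem (J i')) ?bJ //= nest ge_min lexx.
Qed.

Lemma decomposable (V W : pmod R F) (f : pmor V W) (d : R) :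
  invertible d f -> ((2 * d)%:E < Xi V)%E -> ((2 * d)%:E < Xi W)%E ->
  ladder_decomposable f.
Proof.
move=> [d0 [Psi PsiP]] gV gW.
have [I [J [X _]]] := pmod_gbasis V; have [K [L [Y _]]] := pmod_gbasis W.
have e0 : 0 <= 2 * d by lra.
have [X' [Y' mt]] := normal_form e0 (fun t h => (PsiP t h).1) (fun t h => (PsiP t h).2)
  X Y (lt_Xi gV X) (lt_Xi gW Y).
have [M [r [q [rI qK H]]]] := realizes_gens mt.
apply: realizes_decomposable H _ _.
  by exists I, J, X', r.
by exists K, L, Y', q.
Qed.

(** Generators of the short summand, carried through the splitting, complete any basis of the long
    one. *)
Lemma extends_along_gens (q : R) (V : pmod R F) (S : qsplitting q V)
    (B : seq (bargen (qge S))) :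
  gen_list B -> extends_along (in_ge S) B.
Proof.
move=> gB; split; first exact: gen_list_barcode.
have [C [gC _]] := pmod_gens (qlt S).
exists (map (gmap (mcomp (bwd (qiso S)) (pinr (qge S) (qlt S)))) C).
apply: gen_list_barcode.
have := gen_list_iso (piso_bij (qiso S)).2 (gen_list_psum gB gC).
by rewrite map_cat -!map_comp.
Qed.

(** Valid for every decomposition [D]: the canonical generators of an interval sum form a basis, and
    isomorphisms preserve this. *)
Lemma gen_list_dom_basis (V W : pfunctor R F) (f : pmor V W) M
  (D : liso (Ladder f) (lmodule_sum F M)) : gen_list (dom_basis D).
Proof. exact: gen_list_iso (piso_bij _).2 (gen_list_dom _ _). Qed.

Lemma gen_list_cod_basis (V W : pfunctor R F) (f : pmor V W) M
  (D : liso (Ladder f) (lmodule_sum F M)) : gen_list (cod_basis D).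
Proof. exact: gen_list_iso (piso_bij _).2 (gen_list_cod _ _). Qed.

Lemma lt_half_min (d q : R) (x y : \bar R) :
  (d%:E < (2^-1)%:E * Order.min x y - (q / 2)%:E)%E ->
  ((2 * (d + q / 2))%:E < x)%E /\ ((2 * (d + q / 2))%:E < y)%E.
Proof.
move=> h; suff : ((2 * (d + q / 2))%:E < Order.min x y)%E by rewrite lt_min => /andP.
move: h; case: (Order.min x y) => [z||].
- by rewrite -EFinM -EFinB !lte_fin; lra.
- by rewrite ltry.
- by rewrite gt0_muleNy // lte_fin invr_gt0.
Qed.

Lemma retract_id q (V : pfunctor R F) (i : pmor V V) :
  (forall t x, i t x = x) -> almost_retract q i i.
Proof. by move=> iE; split=> [t x|s t h _ x]; rewrite !iE. Qed.

End Decompose.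

Theorem theorem4p4 (R : realType) (F : fieldType) (V W : pmod R F)
  (delta q : R) (hdelta : 0 <= delta) (hq : 0 <= q)
  (Phi : pmor V W) (hPhi : invertible delta Phi)
  (SV : qsplitting q V) (SW : qsplitting q W) :
  [/\ (delta%:E < (2^-1)%:E * Order.min (Xi V) (Xi (qge SW)) - (q / 2)%:E)%E ->
      let f := mcomp (pr_ge SW) Phi in
      [/\ invertible (delta + q / 2) f,
          ladder_decomposable f &
          forall L (D : liso (Ladder f) (lmodule_sum F L)),
            barcode_basis (dom_basis D) /\
            extends_along (in_ge SW) (cod_basis D)],
      (delta%:E < (2^-1)%:E * Order.min (Xi (qge SV)) (Xi W) - (q / 2)%:E)%E ->
      let f := mcomp Phi (in_ge SV) in
      [/\ invertible (delta + q / 2) f,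
          ladder_decomposable f &
          forall L (D : liso (Ladder f) (lmodule_sum F L)),
            extends_along (in_ge SV) (dom_basis D) /\
            barcode_basis (cod_basis D)] &
      (delta%:E < (2^-1)%:E * Order.min (Xi (qge SV)) (Xi (qge SW)) -
                  (q / 2)%:E)%E ->
      let f := mcomp (pr_ge SW) (mcomp Phi (in_ge SV)) in
      [/\ invertible (delta + q / 2) f,
          ladder_decomposable f &
          forall L (D : liso (Ladder f) (lmodule_sum F L)),
            extends_along (in_ge SV) (dom_basis D) /\
            extends_along (in_ge SW) (cod_basis D)]].
Proof.
(* An identity morphism serves as the retract on a side that is not truncated; going through the
   splitting and back provides one. *)
have [idV idVE] : exists i : pmor V V, forall t x, i t x = x.
  by exists (mcomp (bwd (qiso SV)) (fwd (qiso SV))) => t x /=; rewrite fwdK.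
have [idW idWE] : exists i : pmor W W, forall t x, i t x = x.
  by exists (mcomp (bwd (qiso SW)) (fwd (qiso SW))) => t x /=; rewrite fwdK.
have rV := retract_id q idVE; have rW := retract_id q idWE.
split=> /lt_half_min [h1 h2] f.
- have finv : invertible (delta + q / 2) f.
    apply: (invertible_retract hq rV (retract_ge SW) _ hPhi) => t x.
    by rewrite idVE.
  split=> [//||L D]; first exact: decomposable h1 h2.
  split; [apply: gen_list_barcode|apply: extends_along_gens].
    exact: gen_list_dom_basis.
  exact: gen_list_cod_basis.
- have finv : invertible (delta + q / 2) f.
    apply: (invertible_retract hq (retract_ge SV) rW _ hPhi) => t x.
    by rewrite idWE.
  split=> [//||L D]; first exact: decomposable h1 h2.
  split; [apply: extends_along_gens|apply: gen_list_barcode].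
    exact: gen_list_dom_basis.
  exact: gen_list_cod_basis.
- have finv : invertible (delta + q / 2) f.
    exact: (invertible_retract hq (retract_ge SV) (retract_ge SW) _ hPhi).
  split=> [//||L D]; first exact: decomposable h1 h2.
  split; apply: extends_along_gens.
    exact: gen_list_dom_basis.
  exact: gen_list_cod_basis.
Qed.
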